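(* Let $k$ be a field. (a) The functor $\otimes^*\colon\mathsf{Top}_k\times\mathsf{Top}_k\to\mathsf{Top}_k$ preserves the kernels and cokernels of morphisms (in each of its arguments). Fixing a topological vector space in one of the arguments, it becomes an exact endofunctor $\mathsf{Top}_k\to\mathsf{Top}_k$ in the other argument (with respect to the quasi-abelian exact structure on $\mathsf{Top}_k$). (b) The functor $\otimes^{\leftarrow}\colon\mathsf{Top}_k\times\mathsf{Top}_k\to\mathsf{Top}_k$ preserves the kernels and cokernels of morphisms (in each of its arguments). Fixing a topological vector space in any one of the arguments, it becomes an exact endofunctor $\mathsf{Top}_k\to\mathsf{Top}_k$ in the other argument (with respect to the quasi-abelian exact structure on $\mathsf{Top}_k$). (c) The functor $\otimes^!\colon\mathsf{Top}_k\times\mathsf{Top}_k\to\mathsf{Top}_k$ preserves the kernels and cokernels of morphisms (in each of its arguments). Fixing a topological vector space in one of the arguments, it becomes an exact endofunctor $\mathsf{Top}_k\to\mathsf{Top}_k$ in the other argument (with respect to the quasi-abelian exact structure on $\mathsf{Top}_k$).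
   Context: All topological $k$-vector spaces ($k$ a fixed field with the discrete topology) have linear topology: open vector subspaces form a base of neighborhoods of zero. $\mathsf{Top}_k$ is the category of (not necessarily separated or complete) topological $k$-vector spaces and continuous $k$-linear maps. It is additive; the kernel of a morphism is the vector space kernel with the induced topology, and the cokernel is the vector space cokernel with the quotient topology. $\mathsf{Top}_k$ is quasi-abelian: the class of all short sequences $0\to A'\overset{i}\to A\overset{p}\to A''\to0$ in which $i$ is a kernel of $p$ and $p$ is a cokernel of $i$ is a (Quillen) exact category structure, called the quasi-abelian exact structure. An additive functor between exact categories is exact if it takes short exact sequences to short exact sequences. For topological vector spaces $U$ and $V$, three linear topologies on $U\otimes_kV$ are defined as follows; the resulting topological vector spaces are denoted by $U\otimes^*V$, $U\otimes^{\leftarrow}V$, $U\otimes^!V$. A subspace $E\subset U\otimes_kV$ is open in $U\otimes^*V$ if: there exist open subspaces $P\subset U$, $Q\subset V$ with $P\otimes_kQ\subset E$; for every $u\in U$ there is an open subspace $Q_u\subset V$ with $u\otimes Q_u\subset E$; and for every $v\in V$ there is an open subspace $P_v\subset U$ with $P_v\otimes v\subset E$. A subspace $E$ is open in $U\otimes^{\leftarrow}V$ if: there exists an open subspace $P\subset U$ with $P\otimes_kV\subset E$; and for every $u\in U$ there is an open subspace $Q_u\subset V$ with $u\otimes Q_u\subset E$. A subspace $E$ is open in $U\otimes^!V$ if there exist open subspaces $P\subset U$, $Q\subset V$ with $P\otimes_kV+U\otimes_kQ\subset E$. On morphisms all three functors are given by $(f,g)\mapsto f\otimes g$. *)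

(* Defs.v *)
From HB Require Import structures.
From mathcomp Require Import all_boot all_algebra.
From mathcomp Require Import all_classical topology.

Set Implicit Arguments.
Unset Strict Implicit.
Unset Printing Implicit Defensive.

Import GRing.Theory.

Local Open Scope classical_set_scope.
Local Open Scope ring_scope.

Definition subspace_set (k : fieldType) (V : lmodType k) (E : set V) : Prop :=
  E 0 /\ forall (a : k) (x y : V), E x -> E y -> E (a *: x + y).

(* As k is discrete, continuity of the scaling k * V -> V amounts to the
   continuity of each homothety. *)
HB.mixin Record isLinTop (k : fieldType) V
    & Topological V & GRing.Lmodule k V := {
  add_continuous : continuous (fun z : V * V => z.1 + z.2);
  homothety_continuous : forall a : k, continuous ( *:%R a : V -> V);
  open_subspace_base : forall A : set V, nbhs (0 : V) A ->
    exists E : set V, [/\ subspace_set E, open E & E `<=` A]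
}.

#[short(type="linTopType")]
HB.structure Definition LinTop (k : fieldType) :=
  {V of Topological V & GRing.Lmodule k V & isLinTop k V}.

Section SubspaceTheory.
Variables (k : fieldType) (V : lmodType k).
Implicit Types E F : set V.

Lemma subspace0 E : subspace_set E -> E 0. Proof. by case. Qed.

Lemma subspaceD E x y : subspace_set E -> E x -> E y -> E (x + y).
Proof. by case=> _ H Ex Ey; rewrite -[x]scale1r; exact: H. Qed.

Lemma subspaceZ E a x : subspace_set E -> E x -> E (a *: x).
Proof. by case=> E0 H Ex; rewrite -[_ *: _]addr0; exact: H. Qed.

Lemma subspaceN E x : subspace_set E -> E x -> E (- x).
Proof. by rewrite -scaleN1r; exact: subspaceZ. Qed.

Lemma subspace_sum E I (s : seq I) (f : I -> V) : subspace_set E ->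
  (forall i, E (f i)) -> E (\sum_(i <- s) f i).
Proof.
move=> sE fE; elim/big_ind: _ => //; first exact: subspace0.
by move=> x y; exact: subspaceD.
Qed.

Lemma subspaceT : subspace_set [set: V]. Proof. by []. Qed.

Lemma subspaceI E F : subspace_set E -> subspace_set F ->
  subspace_set (E `&` F).
Proof.
move=> [E0 EE] [F0 FF]; split=> // a x y [Ex Fx] [Ey Fy].
by split; [exact: EE|exact: FF].
Qed.

Lemma subspace_preimage (W : lmodType k) (f : {linear V -> W}) (E : set W) :
  subspace_set E -> subspace_set (f @^-1` E).
Proof.
move=> [E0 EE]; split=> [|a x y Ex Ey]; first by rewrite /preimage /= linear0.
by rewrite /preimage /= linearP; exact: EE.
Qed.

End SubspaceTheory.

Section LinTopTheory.
Variables (k : fieldType) (V : linTopType k).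
Implicit Types (E A : set V) (x : V).

Lemma nbhs_translate x y A : nbhs (x + y) A -> nbhs y [set z | A (x + z)].
Proof.
move=> /(@add_continuous k V (x, y)) [[B C] /= [Bx Cy] BCA].
by apply: filterS Cy => z Cz; apply: (BCA (x, z)); split=> //; exact: nbhs_singleton.
Qed.

Lemma nbhs_linP x A :
  nbhs x A <-> exists E, [/\ subspace_set E, open E & forall e, E e -> A (x + e)].
Proof.
split=> [|[E [sE oE EA]]].
  rewrite -{1}[x]addr0 => /nbhs_translate /open_subspace_base [E [sE oE EA]].
  by exists E.
have nE : nbhs (0 : V) E by apply: open_nbhs_nbhs; split=> //; exact: subspace0.
rewrite -(addNr x) in nE; move/nbhs_translate: nE; apply: filterS => z /= /EA.
by rewrite addrA subrr add0r.
Qed.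

Lemma subspace_openP E : subspace_set E -> (open E <-> nbhs (0 : V) E).
Proof.
move=> sE; split=> [oE|nE]; first by apply: open_nbhs_nbhs; split=> //; exact: subspace0.
rewrite openE => x Ex; move/nbhs_linP: nE => [F [sF oF FE]].
apply/nbhs_linP; exists F; split=> // e /FE; rewrite add0r => Ee.
exact: subspaceD.
Qed.

End LinTopTheory.

Section LinearContinuous.
Variables (k : fieldType) (V W : linTopType k) (f : {linear V -> W}).

Lemma linear_continuousP : continuous f <->
  forall E : set W, subspace_set E -> open E -> open (f @^-1` E).
Proof.
split=> [/continuousP cf E _ /cf //|H x A /nbhs_linP [E [sE oE EA]]].
apply/nbhs_linP; exists (f @^-1` E); split; [|exact: H|].
  exact: subspace_preimage.
by move=> e /= /EA; rewrite linearD.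
Qed.

End LinearContinuous.

(* The linear topology whose open subspaces are the members of a given filter
   of subspaces. *)
Record subspace_filter (k : fieldType) (V : lmodType k) := SubspaceFilter {
  sf_mem :> set V -> Prop;
  sf_subspace : forall E, sf_mem E -> subspace_set E;
  sf_setT : sf_mem setT;
  sf_setI : forall E F, sf_mem E -> sf_mem F -> sf_mem (E `&` F);
  sf_up : forall E F, subspace_set F -> E `<=` F -> sf_mem E -> sf_mem F
}.

Definition lintop (k : fieldType) (V : lmodType k) (B : subspace_filter V)
  : Type := V.

Section Lintop.
Variables (k : fieldType) (V : lmodType k) (B : subspace_filter V).

HB.instance Definition _ := GRing.Lmodule.on (lintop B).

Definition lintop_nbhs (x : lintop B) : set_system (lintop B) :=
  [set A | exists2 E, B E & [set x + e | e in E] `<=` A].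

HB.instance Definition _ := hasNbhs.Build (lintop B) lintop_nbhs.

Let lintop_nbhs_filter (x : lintop B) : ProperFilter (nbhs x).
Proof.
apply: Build_ProperFilter_ex.
  move=> A [E BE EA]; exists (x + 0); apply: EA; exists 0 => //.
  exact: subspace0 (sf_subspace BE).
split.
- by exists setT => //; exact: sf_setT.
- move=> A A' [E BE EA] [E' BE' EA']; exists (E `&` E'); first exact: sf_setI.
  by move=> _ [e [Ee E'e] <-]; split; [apply: EA|apply: EA']; exists e.
- by move=> A A' AA' [E BE EA]; exists E => // y /EA /AA'.
Qed.

Let lintop_nbhs_singleton (x : lintop B) (A : set (lintop B)) :
  nbhs x A -> A x.
Proof.
case=> E BE; apply; exists 0; last by rewrite addr0.
exact: subspace0 (sf_subspace BE).
Qed.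

Let lintop_nbhs_nbhs (x : lintop B) (A : set (lintop B)) :
  nbhs x A -> nbhs x (nbhs^~ A).
Proof.
case=> E BE EA; exists E => // _ [e Ee <-]; exists E => // _ [e' Ee' <-].
by apply: EA; exists (e + e'); rewrite ?addrA//; exact: subspaceD (sf_subspace BE) _ _.
Qed.

HB.instance Definition _ := Nbhs_isNbhsTopological.Build (lintop B)
  lintop_nbhs_filter lintop_nbhs_singleton lintop_nbhs_nbhs.

Lemma lintop_openP (E : set (lintop B)) :
  subspace_set (E : set V) -> (open E <-> B E).
Proof.
move=> sE; rewrite openE; split=> [/(_ 0 (subspace0 sE))|BE x Ex].
  case=> F BF FE; apply: (sf_up sE _ BF) => e Fe; apply: FE.
  by exists e; rewrite ?add0r.
by exists E => // _ [e Ee <-]; exact: subspaceD.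
Qed.

Let lintop_add : continuous (fun z : lintop B * lintop B => z.1 + z.2).
Proof.
move=> [x y] A [E BE EA].
exists ([set x + e | e in E], [set y + e | e in E]) => /=.
  by split; exists E.
move=> [y1 y2] /= [[e Ee <-] [e' Ee' <-]]; rewrite addrACA; apply: EA.
by exists (e + e') => //; exact: subspaceD (sf_subspace BE) _ _.
Qed.

Let lintop_homothety (a : k) : continuous ( *:%R a : lintop B -> lintop B).
Proof.
move=> x A [E BE EA]; exists E => // _ [e Ee <-]; rewrite /= scalerDr.
by apply: EA; exists (a *: e) => //; exact: subspaceZ (sf_subspace BE) _.
Qed.

Let lintop_base (A : set (lintop B)) : nbhs (0 : lintop B) A ->
  exists E : set (lintop B), [/\ subspace_set E, open E & E `<=` A].
Proof.
case=> E BE EA; have sE := sf_subspace BE; exists E; split=> //.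
  exact/lintop_openP.
by move=> e Ee; apply: EA; exists e; rewrite ?add0r.
Qed.

HB.instance Definition _ := isLinTop.Build k (lintop B)
  lintop_add lintop_homothety lintop_base.

End Lintop.

Section Hom.
Variable k : fieldType.

Record hom (U V : linTopType k) := Hom {
  hom_fun :> {linear U -> V};
  hom_continuous : continuous hom_fun
}.

Lemma homP (U V : linTopType k) (f g : hom U V) : f =1 g -> f = g.
Proof.
case: f g => [[f [[fD] [fZ]]] fc] [[g [[gD] [gZ]]] gc] /= /funext efg.
rewrite /= in efg fc gc *; case: _ / efg in gD gZ gc *.
rewrite (Prop_irrelevance gD fD) (Prop_irrelevance gZ fZ).
by rewrite (Prop_irrelevance fc gc).
Qed.

Lemma hom_id_continuous (U : linTopType k) : continuous (@idfun U).
Proof. by move=> x A. Qed.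

Definition hom_id (U : linTopType k) : hom U U :=
  @Hom U U idfun (@hom_id_continuous U).

Lemma hom_comp_continuous (U V W : linTopType k) (g : hom V W) (f : hom U V) :
  continuous (g \o f).
Proof. by move=> x; apply: continuous_comp; apply: hom_continuous. Qed.

Definition hom_comp (U V W : linTopType k) (g : hom V W) (f : hom U V)
    : hom U W :=
  @Hom U W (g \o f) (@hom_comp_continuous U V W g f).

Lemma hom_zero_continuous (U V : linTopType k) :
  continuous (\0 : U -> V).
Proof. exact: cst_continuous. Qed.

Definition hom_zero (U V : linTopType k) : hom U V :=
  @Hom U V \0 (@hom_zero_continuous U V).

Lemma hom_add_continuous (U V : linTopType k) (f g : hom U V) :
  continuous (f \+ g).
Proof.
move=> x; apply: (@continuous2_cvg _ _ _ _ _ _ f g (fun y z => y + z)).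
- exact: (@add_continuous k V (f x, g x)).
- exact: hom_continuous.
- exact: hom_continuous.
Qed.

Definition hom_add (U V : linTopType k) (f g : hom U V) : hom U V :=
  @Hom U V (f \+ g) (@hom_add_continuous U V f g).

(* Kernels and cokernels are meant in the category of linTopType k and hom. *)
Definition is_kernel (K U V : linTopType k) (i : hom K U) (f : hom U V) : Prop :=
  hom_comp f i = hom_zero K V /\
  forall (T : linTopType k) (t : hom T U), hom_comp f t = hom_zero T V ->
    exists! s : hom T K, hom_comp i s = t.

Definition is_cokernel (U V C : linTopType k) (p : hom V C) (f : hom U V) : Prop :=
  hom_comp p f = hom_zero U C /\
  forall (T : linTopType k) (t : hom V T), hom_comp t f = hom_zero U T ->
    exists! s : hom C T, hom_comp s p = t.

(* Admissible short exact sequences 0 -> A' -> A -> A'' -> 0 of the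
   quasi-abelian exact structure. *)
Definition short_exact (A' A A'' : linTopType k) (i : hom A' A) (p : hom A A'')
  : Prop := is_kernel i p /\ is_cokernel p i.

Record endofunctor := Endofunctor {
  fobj :> linTopType k -> linTopType k;
  fmap : forall U V, hom U V -> hom (fobj U) (fobj V);
  fmap_id : forall U, fmap (hom_id U) = hom_id (fobj U);
  fmap_comp : forall U V W (g : hom V W) (f : hom U V),
    fmap (hom_comp g f) = hom_comp (fmap g) (fmap f)
}.

Definition additive_functor (F : endofunctor) : Prop :=
  forall (U V : linTopType k) (f g : hom U V),
    fmap F (hom_add f g) = hom_add (fmap F f) (fmap F g).

Definition preserves_kernels (F : endofunctor) : Prop :=
  forall (K U V : linTopType k) (i : hom K U) (f : hom U V),
    is_kernel i f -> is_kernel (fmap F i) (fmap F f).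

Definition preserves_cokernels (F : endofunctor) : Prop :=
  forall (U V C : linTopType k) (p : hom V C) (f : hom U V),
    is_cokernel p f -> is_cokernel (fmap F p) (fmap F f).

Definition exact_functor (F : endofunctor) : Prop :=
  additive_functor F /\
  forall (A' A A'' : linTopType k) (i : hom A' A) (p : hom A A''),
    short_exact i p -> short_exact (fmap F i) (fmap F p).

Record bifunctor := Bifunctor {
  bobj :> linTopType k -> linTopType k -> linTopType k;
  bmap : forall U U' V V', hom U U' -> hom V V' -> hom (bobj U V) (bobj U' V');
  bmap_id : forall U V, bmap (hom_id U) (hom_id V) = hom_id (bobj U V);
  bmap_comp : forall U U' U'' V V' V'' (f' : hom U' U'') (f : hom U U')
      (g' : hom V' V'') (g : hom V V'),
    bmap (hom_comp f' f) (hom_comp g' g) = hom_comp (bmap f' g') (bmap f g)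
}.

Section FixArgument.
Variables (F : bifunctor) (X : linTopType k).

Lemma comp_id1 : hom_comp (hom_id X) (hom_id X) = hom_id X.
Proof. exact: homP. Qed.

Lemma fix_left_comp U V W (g : hom V W) (f : hom U V) :
  bmap F (hom_id X) (hom_comp g f) =
  hom_comp (bmap F (hom_id X) g) (bmap F (hom_id X) f).
Proof. by rewrite -bmap_comp comp_id1. Qed.

Lemma fix_right_comp U V W (g : hom V W) (f : hom U V) :
  bmap F (hom_comp g f) (hom_id X) =
  hom_comp (bmap F g (hom_id X)) (bmap F f (hom_id X)).
Proof. by rewrite -bmap_comp comp_id1. Qed.

Definition fix_left : endofunctor :=
  @Endofunctor (F X) (fun U V => @bmap F X X U V (hom_id X))
    (bmap_id F X) fix_left_comp.

Definition fix_right : endofunctor :=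
  @Endofunctor (F^~ X) (fun U V f => @bmap F U V X X f (hom_id X))
    ((bmap_id F)^~ X) fix_right_comp.

End FixArgument.

Definition in_each_argument (P : endofunctor -> Prop) (F : bifunctor) : Prop :=
  forall X : linTopType k, P (fix_left F X) /\ P (fix_right F X).

End Hom.

Section Tensor.
Variables (k : fieldType) (U V : lmodType k).

(* The sequence [:: (u1, v1); ...] stands for the formal sum of the ui (x) vi;
   tensor_rel is the congruence generated by bilinearity. *)
Inductive tensor_rel : seq (U * V) -> seq (U * V) -> Prop :=
| tensor_rel_refl s : tensor_rel s s
| tensor_rel_sym s t : tensor_rel s t -> tensor_rel t s
| tensor_rel_trans s t r : tensor_rel s t -> tensor_rel t r -> tensor_rel s r
| tensor_rel_cat s s' t t' : tensor_rel s s' -> tensor_rel t t' ->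
    tensor_rel (s ++ t) (s' ++ t')
| tensor_rel_catC s t : tensor_rel (s ++ t) (t ++ s)
| tensor_rel_0 v : tensor_rel [:: (0, v)] [::]
| tensor_rel_Dl u u' v : tensor_rel [:: (u + u', v)] [:: (u, v); (u', v)]
| tensor_rel_Dr u v v' : tensor_rel [:: (u, v + v')] [:: (u, v); (u, v')]
| tensor_rel_Z a u v : tensor_rel [:: (a *: u, v)] [:: (u, a *: v)].

Definition tensor_relb : rel (seq (U * V)) := fun s t => `[< tensor_rel s t >].

Lemma tensor_relb_equiv : equiv_class_of tensor_relb.
Proof.
split.
- by move=> s; apply/asboolP; exact: tensor_rel_refl.
- by move=> s t; apply/asboolP/asboolP => /tensor_rel_sym.
- move=> t s r /asboolP st /asboolP tr; apply/asboolP.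
  exact: tensor_rel_trans st tr.
Qed.

Canonical tensor_equiv := EquivRelPack tensor_relb_equiv.

Definition tensor := {eq_quot tensor_equiv}%qT.

HB.instance Definition _ := Choice.on tensor.

Definition formal_sum (s : seq (U * V)) : tensor := (\pi_(tensor) s)%qT.

Lemma formal_sumP s t : formal_sum s = formal_sum t <-> tensor_rel s t.
Proof.
split=> [/eqmodP/asboolP //|st]; apply/eqmodP; exact/asboolP.
Qed.

Lemma formal_sum_surj x : exists s, x = formal_sum s.
Proof. by exists (repr x); rewrite /formal_sum reprK. Qed.

Definition scale_seq (a : k) (s : seq (U * V)) := [seq (a *: z.1, z.2) | z <- s].

Lemma tensor_rel_scale a s t :
  tensor_rel s t -> tensor_rel (scale_seq a s) (scale_seq a t).
Proof.
elim=> {s t} /=.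
- by move=> s; exact: tensor_rel_refl.
- by move=> s t _; exact: tensor_rel_sym.
- by move=> s t r _ st _; exact: tensor_rel_trans.
- by move=> s s' t t' _ ss' _ tt'; rewrite /scale_seq !map_cat; exact: tensor_rel_cat.
- by move=> s t; rewrite /scale_seq !map_cat; exact: tensor_rel_catC.
- by move=> v; rewrite scaler0; exact: tensor_rel_0.
- by move=> u u' v; rewrite scalerDr; exact: tensor_rel_Dl.
- by move=> u v v'; exact: tensor_rel_Dr.
- move=> b u v; rewrite scalerA mulrC -scalerA; exact: tensor_rel_Z.
Qed.

Definition tensor_add (x y : tensor) := formal_sum (repr x ++ repr y).
Definition tensor_scale a (x : tensor) := formal_sum (scale_seq a (repr x)).

Lemma repr_formal_sum s : tensor_rel (repr (formal_sum s)) s.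
Proof. by apply/formal_sumP; rewrite /formal_sum reprK. Qed.

Lemma tensor_addE s t :
  tensor_add (formal_sum s) (formal_sum t) = formal_sum (s ++ t).
Proof. by apply/formal_sumP; apply: tensor_rel_cat; exact: repr_formal_sum. Qed.

Lemma tensor_scaleE a s :
  tensor_scale a (formal_sum s) = formal_sum (scale_seq a s).
Proof. by apply/formal_sumP/tensor_rel_scale; exact: repr_formal_sum. Qed.

Lemma tensor_addA : associative tensor_add.
Proof.
move=> x y z; have [s ->] := formal_sum_surj x; have [t ->] := formal_sum_surj y.
by have [r ->] := formal_sum_surj z; rewrite !tensor_addE catA.
Qed.

Lemma tensor_addC : commutative tensor_add.
Proof.
move=> x y; have [s ->] := formal_sum_surj x; have [t ->] := formal_sum_surj y.
by rewrite !tensor_addE; apply/formal_sumP; exact: tensor_rel_catC.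
Qed.

Lemma tensor_add0 : left_id (formal_sum [::]) tensor_add.
Proof. by move=> x; have [s ->] := formal_sum_surj x; rewrite tensor_addE. Qed.

Lemma tensor_scaleDl x a b :
  tensor_scale (a + b) x = tensor_add (tensor_scale a x) (tensor_scale b x).
Proof.
have [s ->] := formal_sum_surj x; rewrite !tensor_scaleE.
have consE z r : formal_sum (z :: r) = tensor_add (formal_sum [:: z]) (formal_sum r).
  by rewrite tensor_addE.
elim: s => [|[u v] s IHs]; first by rewrite tensor_add0.
have scE c : scale_seq c ((u, v) :: s) = (c *: u, v) :: scale_seq c s by [].
rewrite !scE (consE _ (scale_seq (a + b) s)) (consE _ (scale_seq a s)).
rewrite (consE _ (scale_seq b s)) IHs.
have -> : formal_sum [:: ((a + b) *: u, v)] =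
    tensor_add (formal_sum [:: (a *: u, v)]) (formal_sum [:: (b *: u, v)]).
  by rewrite tensor_addE scalerDl; apply/formal_sumP; exact: tensor_rel_Dl.
rewrite -!tensor_addA; congr tensor_add; rewrite !tensor_addA.
by rewrite [tensor_add (formal_sum [:: _]) _]tensor_addC.
Qed.

Lemma tensor_scale0 x : tensor_scale 0 x = formal_sum [::].
Proof.
have [s ->] := formal_sum_surj x; rewrite tensor_scaleE.
elim: s => [|[u v] s IHs] //=.
rewrite -cat1s -tensor_addE IHs tensor_addC tensor_add0 scale0r.
by apply/formal_sumP; exact: tensor_rel_0.
Qed.

Lemma tensor_scale1 : left_id 1 tensor_scale.
Proof.
move=> x; have [s ->] := formal_sum_surj x; rewrite tensor_scaleE; congr formal_sum.
by elim: s => [|[u v] s IHs] //=; rewrite scale1r IHs.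
Qed.

Lemma tensor_addN : left_inverse (formal_sum [::]) (tensor_scale (- 1)) tensor_add.
Proof.
by move=> x; rewrite -{2}[x]tensor_scale1 -tensor_scaleDl addNr tensor_scale0.
Qed.

HB.instance Definition _ := GRing.isZmodule.Build tensor
  tensor_addA tensor_addC tensor_add0 tensor_addN.

Lemma tensor_scaleA a b x :
  tensor_scale a (tensor_scale b x) = tensor_scale (a * b) x.
Proof.
have [s ->] := formal_sum_surj x; rewrite !tensor_scaleE; congr formal_sum.
by rewrite /scale_seq -map_comp; apply: eq_map => z /=; rewrite scalerA.
Qed.

Lemma tensor_scaleDr : right_distributive tensor_scale +%R.
Proof.
move=> a x y; have [s ->] := formal_sum_surj x; have [t ->] := formal_sum_surj y.
rewrite /GRing.add /= !(tensor_addE, tensor_scaleE); congr formal_sum.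
by rewrite /scale_seq map_cat.
Qed.

HB.instance Definition _ := GRing.Zmodule_isLmodule.Build k tensor
  tensor_scaleA tensor_scale1 tensor_scaleDr
  (fun x a b => tensor_scaleDl x a b).

Definition tens (u : U) (v : V) : tensor := formal_sum [:: (u, v)].

Lemma formal_sumE s : formal_sum s = \sum_(z <- s) tens z.1 z.2.
Proof.
elim: s => [|[u v] s IHs]; first by rewrite big_nil.
by rewrite big_cons -IHs; symmetry; exact: tensor_addE.
Qed.

Lemma tensorP (x : tensor) : exists s, x = \sum_(z <- s) tens z.1 z.2.
Proof. by have [s ->] := formal_sum_surj x; exists s; rewrite formal_sumE. Qed.

Lemma tens_linearl v : linear (tens^~ v).
Proof.
move=> a u u'; rewrite /tens; have /formal_sumP -> := tensor_rel_Dl (a *: u) u' v.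
by rewrite -(cat1s (_, v)) -tensor_addE -[_ *: formal_sum _]/(tensor_scale _ _)
  tensor_scaleE.
Qed.

Lemma tens_linearr u : linear (tens u).
Proof.
move=> a v v'; rewrite /tens; have /formal_sumP -> := tensor_rel_Dr u (a *: v) v'.
rewrite -(cat1s (u, a *: v)) -tensor_addE -[_ *: formal_sum _]/(tensor_scale _ _).
by rewrite tensor_scaleE; have /formal_sumP <- := tensor_rel_Z a u v.
Qed.

Section Lift.
Variables (W : lmodType k) (b : U -> V -> W).
Variables (bl : forall v, linear (b^~ v)) (br : forall u, linear (b u)).

Lemma tensor_rel_lift s t : tensor_rel s t ->
  \sum_(z <- s) b z.1 z.2 = \sum_(z <- t) b z.1 z.2.
Proof.
elim=> {s t} //=.
- by move=> s t r _ -> _ ->.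
- by move=> s s' t t' _ ss' _ tt'; rewrite !big_cat /= ss' tt'.
- by move=> s t; rewrite !big_cat /= addrC.
- move=> v; rewrite big_seq1 big_nil /=.
  by have := bl v (-1) 0 0; rewrite /= scaler0 addr0 scaleN1r addNr.
- move=> u u' v; rewrite big_seq1 big_cons big_seq1 /=.
  by have := bl v 1 u u'; rewrite /= !scale1r.
- move=> u v v'; rewrite big_seq1 big_cons big_seq1 /=.
  by have := br u 1 v v'; rewrite /= !scale1r.
- move=> a u v; rewrite !big_seq1 /=.
  have b0 : b 0 v = 0 by have := bl v (-1) 0 0; rewrite /= scaler0 addr0 scaleN1r addNr.
  have b0' : b u 0 = 0 by have := br u (-1) 0 0; rewrite /= scaler0 addr0 scaleN1r addNr.
  have := bl v a u 0; have := br u a v 0; rewrite /= !addr0 b0 b0' !addr0.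
  by move=> -> ->.
Qed.

(* The proofs are arguments of tensor_lift so that its linear structure can be
   inferred. *)
Definition tensor_lift of (forall v, linear (b^~ v)) & (forall u, linear (b u)) :=
  fun x : tensor => \sum_(z <- (repr x : seq (U * V))) b z.1 z.2.

Lemma tensor_lift_sum s :
  tensor_lift bl br (formal_sum s) = \sum_(z <- s) b z.1 z.2.
Proof. exact/tensor_rel_lift/repr_formal_sum. Qed.

Lemma tensor_lift_linear : linear (tensor_lift bl br).
Proof.
move=> a x y; have [s ->] := formal_sum_surj x; have [t ->] := formal_sum_surj y.
have -> : a *: formal_sum s + formal_sum t = formal_sum (scale_seq a s ++ t).
  by rewrite -tensor_addE -tensor_scaleE.
rewrite !tensor_lift_sum big_cat /= big_map scaler_sumr; congr (_ + _).
apply: eq_bigr => -[u v] _ /=.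
have b0 : b 0 v = 0 by have := bl v (-1) 0 0; rewrite /= scaler0 addr0 scaleN1r addNr.
by have := bl v a u 0; rewrite /= !addr0 b0 addr0.
Qed.

HB.instance Definition _ := GRing.isLinear.Build k tensor W *:%R (tensor_lift bl br)
  tensor_lift_linear.

Lemma tensor_liftE u v : tensor_lift bl br (tens u v) = b u v.
Proof. by rewrite tensor_lift_sum big_seq1. Qed.

End Lift.

Lemma tensor_linear_ext (W : lmodType k) (f g : {linear tensor -> W}) :
  (forall u v, f (tens u v) = g (tens u v)) -> f =1 g.
Proof.
move=> fg x; have [s ->] := tensorP x; rewrite !linear_sum.
by apply: eq_bigr => z _; exact: fg.
Qed.

End Tensor.

Section TensorMap.
Variables (k : fieldType) (U V U' V' : lmodType k).
Variables (f : {linear U -> U'}) (g : {linear V -> V'}).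

Lemma tensor_map_linearl v : linear (fun u => tens (f u) (g v)).
Proof. by move=> a u u'; rewrite linearP tens_linearl. Qed.

Lemma tensor_map_linearr u : linear (fun v => tens (f u) (g v)).
Proof. by move=> a v v'; rewrite linearP tens_linearr. Qed.

Definition tensor_map : tensor U V -> tensor U' V' :=
  tensor_lift tensor_map_linearl tensor_map_linearr.

HB.instance Definition _ := GRing.Linear.on tensor_map.

Lemma tensor_mapE u v : tensor_map (tens u v) = tens (f u) (g v).
Proof. exact: tensor_liftE. Qed.

End TensorMap.

(* For subspaces P and Q, the subspace P (x) Q of U (x) V. *)
Definition tensor_set (k : fieldType) (U V : lmodType k) (P : set U) (Q : set V)
    : set (tensor U V) :=
  [set x | exists2 s : seq (U * V),
    (forall z, z \in s -> P z.1 /\ Q z.2) & x = \sum_(z <- s) tens z.1 z.2].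

Lemma tensor_set_subP (k : fieldType) (U V : lmodType k) (P : set U) (Q : set V)
    (E : set (tensor U V)) : subspace_set E ->
  (tensor_set P Q `<=` E <-> forall u v, P u -> Q v -> E (tens u v)).
Proof.
move=> sE; split=> [PQE u v Pu Qv|PQE _ [s sPQ ->]].
  apply: PQE; exists [:: (u, v)]; last by rewrite big_seq1.
  by move=> z; rewrite inE => /eqP ->.
rewrite big_seq; elim/big_ind: _ => [||z /sPQ [Pz Qz]]; first exact: subspace0.
  by move=> x y; exact: subspaceD.
exact: PQE.
Qed.

Definition open_subspace (k : fieldType) (V : linTopType k) (E : set V) : Prop :=
  subspace_set E /\ open E.

Section TensorTopologies.
Variable k : fieldType.

Lemma open_subspaceT (V : linTopType k) : open_subspace [set: V].
Proof. by split; [exact: subspaceT|exact: openT]. Qed.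

Lemma open_subspaceI (V : linTopType k) (E F : set V) :
  open_subspace E -> open_subspace F -> open_subspace (E `&` F).
Proof.
by move=> [sE oE] [sF oF]; split; [exact: subspaceI|exact: openI].
Qed.

Lemma open_subspace_preimage (V W : linTopType k) (f : hom V W) (E : set W) :
  open_subspace E -> open_subspace (f @^-1` E).
Proof.
move=> [sE oE]; split; first exact: subspace_preimage.
by move/continuousP: (@hom_continuous _ _ _ f); exact.
Qed.

Section Families.
Variables U V : linTopType k.
Implicit Types E : set (tensor U V).

(* The open subspaces of the tensor products with exponents *, <- and !. *)
Definition star_open E : Prop :=
  [/\ subspace_set E,
      exists (P : set U) (Q : set V),
        [/\ open_subspace P, open_subspace Q & tensor_set P Q `<=` E],
      forall u : U, exists2 Q : set V, open_subspace Q &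
        [set tens u v | v in Q] `<=` E
    & forall v : V, exists2 P : set U, open_subspace P &
        [set tens u v | u in P] `<=` E].

Definition arrow_open E : Prop :=
  [/\ subspace_set E,
      exists2 P : set U, open_subspace P & tensor_set P [set: V] `<=` E
    & forall u : U, exists2 Q : set V, open_subspace Q &
        [set tens u v | v in Q] `<=` E].

Definition shriek_open E : Prop :=
  subspace_set E /\
  exists (P : set U) (Q : set V), [/\ open_subspace P, open_subspace Q &
    [set x + y | x in tensor_set P [set: V] & y in tensor_set [set: U] Q]
      `<=` E].

Let star_setT : star_open setT.
Proof.
split=> //; [exists setT, setT; split=> //; exact: open_subspaceT| |].
- by move=> u; exists setT => //; exact: open_subspaceT.
- by move=> u; exists setT => //; exact: open_subspaceT.
Qed.

Let star_setI E F : star_open E -> star_open F -> star_open (E `&` F).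
Proof.
move=> [sE [P [Q [oP oQ PQE]]] El Er] [sF [P' [Q' [oP' oQ' PQF]]] Fl Fr]; split.
- exact: subspaceI.
- exists (P `&` P'), (Q `&` Q'); split; [exact: open_subspaceI..|].
  move=> _ [s sPQ ->]; split; [apply: PQE|apply: PQF]; exists s => // z /sPQ.
    by case=> -[? _] [].
  by case=> -[_ ?] [].
- move=> u; have [A oA AE] := El u; have [B oB BF] := Fl u.
  exists (A `&` B); first exact: open_subspaceI.
  by move=> _ [v [Av Bv] <-]; split; [apply: AE|apply: BF]; exists v.
- move=> v; have [A oA AE] := Er v; have [B oB BF] := Fr v.
  exists (A `&` B); first exact: open_subspaceI.
  by move=> _ [u [Au Bu] <-]; split; [apply: AE|apply: BF]; exists u.
Qed.

Let star_up E F : subspace_set F -> E `<=` F -> star_open E -> star_open F.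
Proof.
move=> sF EF [_ [P [Q [oP oQ PQE]]] El Er]; split=> //.
- by exists P, Q; split=> // x /PQE /EF.
- by move=> u; have [A oA AE] := El u; exists A => // x /AE /EF.
- by move=> v; have [A oA AE] := Er v; exists A => // x /AE /EF.
Qed.

Definition star_filter : subspace_filter (tensor U V) :=
  @SubspaceFilter k (tensor U V) star_open
    (fun E H => let: And4 sE _ _ _ := H in sE) star_setT star_setI star_up.

Let arrow_setT : arrow_open setT.
Proof.
split=> //; first by exists setT => //; exact: open_subspaceT.
by move=> u; exists setT => //; exact: open_subspaceT.
Qed.

Let arrow_setI E F : arrow_open E -> arrow_open F -> arrow_open (E `&` F).
Proof.
move=> [sE [P oP PE] El] [sF [P' oP' PF] Fl]; split.
- exact: subspaceI.
- exists (P `&` P'); first exact: open_subspaceI.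
  move=> _ [s sPQ ->]; split; [apply: PE|apply: PF]; exists s => // z /sPQ.
    by case=> -[].
  by case=> -[].
- move=> u; have [A oA AE] := El u; have [B oB BF] := Fl u.
  exists (A `&` B); first exact: open_subspaceI.
  by move=> _ [v [Av Bv] <-]; split; [apply: AE|apply: BF]; exists v.
Qed.

Let arrow_up E F : subspace_set F -> E `<=` F -> arrow_open E -> arrow_open F.
Proof.
move=> sF EF [_ [P oP PE] El]; split=> //.
- by exists P => // x /PE /EF.
- by move=> u; have [A oA AE] := El u; exists A => // x /AE /EF.
Qed.

Definition arrow_filter : subspace_filter (tensor U V) :=
  @SubspaceFilter k (tensor U V) arrow_open
    (fun E H => let: And3 sE _ _ := H in sE) arrow_setT arrow_setI arrow_up.

Let shriek_setT : shriek_open setT.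
Proof. by split=> //; exists setT, setT; split=> //; exact: open_subspaceT. Qed.

Let shriek_setI E F : shriek_open E -> shriek_open F -> shriek_open (E `&` F).
Proof.
move=> [sE [P [Q [oP oQ PQE]]]] [sF [P' [Q' [oP' oQ' PQF]]]].
split; first exact: subspaceI.
exists (P `&` P'), (Q `&` Q'); split; [exact: open_subspaceI..|].
move=> _ [_ [s sP ->] [_ [t tQ ->] <-]]; split.
- apply: PQE; exists (\sum_(z <- s) tens z.1 z.2).
    by exists s => // z /sP [] [].
  by exists (\sum_(z <- t) tens z.1 z.2) => //; exists t => // z /tQ [_ []].
- apply: PQF; exists (\sum_(z <- s) tens z.1 z.2).
    by exists s => // z /sP [] [].
  by exists (\sum_(z <- t) tens z.1 z.2) => //; exists t => // z /tQ [_ []].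
Qed.

Let shriek_up E F :
  subspace_set F -> E `<=` F -> shriek_open E -> shriek_open F.
Proof.
move=> sF EF [_ [P [Q [oP oQ PQE]]]]; split=> //.
by exists P, Q; split=> // x /PQE /EF.
Qed.

Definition shriek_filter : subspace_filter (tensor U V) :=
  @SubspaceFilter k (tensor U V) shriek_open
    (fun E H => let: conj sE _ := H in sE) shriek_setT shriek_setI shriek_up.

End Families.

Definition tensor_star (U V : linTopType k) : linTopType k :=
  lintop (star_filter U V).
Definition tensor_arrow (U V : linTopType k) : linTopType k :=
  lintop (arrow_filter U V).
Definition tensor_shriek (U V : linTopType k) : linTopType k :=
  lintop (shriek_filter U V).

Section Maps.
Variables (U U' V V' : linTopType k) (f : hom U U') (g : hom V V').

Lemma tensor_set_map (P : set U') (Q : set V') (E : set (tensor U' V')) :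
  subspace_set E -> tensor_set P Q `<=` E ->
  tensor_set (f @^-1` P) (g @^-1` Q) `<=` tensor_map f g @^-1` E.
Proof.
move=> sE /tensor_set_subP PQE.
apply/tensor_set_subP; first exact: subspace_preimage.
by move=> u v Pu Qv; rewrite /preimage /= tensor_mapE; exact: PQE.
Qed.

Lemma tensor_star_continuous :
  continuous (tensor_map f g : tensor_star U V -> tensor_star U' V').
Proof.
apply/(@linear_continuousP _ (tensor_star U V) (tensor_star U' V')) => E sE.
move=> /(lintop_openP sE) [_ [P [Q [oP oQ PQE]]] El Er].
apply/lintop_openP; first exact: subspace_preimage.
split; first exact: subspace_preimage.
- exists (f @^-1` P), (g @^-1` Q); split; [exact: open_subspace_preimage..|].
  exact: tensor_set_map.
- move=> u; have [Q' oQ' Q'E] := El (f u).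
  exists (g @^-1` Q'); first exact: open_subspace_preimage.
  by move=> _ [v Qv <-]; rewrite /preimage /= tensor_mapE; apply: Q'E; exists (g v).
- move=> v; have [P' oP' P'E] := Er (g v).
  exists (f @^-1` P'); first exact: open_subspace_preimage.
  by move=> _ [u Pu <-]; rewrite /preimage /= tensor_mapE; apply: P'E; exists (f u).
Qed.

Lemma tensor_arrow_continuous :
  continuous (tensor_map f g : tensor_arrow U V -> tensor_arrow U' V').
Proof.
apply/(@linear_continuousP _ (tensor_arrow U V) (tensor_arrow U' V')) => E sE.
move=> /(lintop_openP sE) [_ [P oP PE] El].
apply/lintop_openP; first exact: subspace_preimage.
split; first exact: subspace_preimage.
- exists (f @^-1` P); first exact: open_subspace_preimage.
  exact: (@tensor_set_map P setT).
- move=> u; have [Q' oQ' Q'E] := El (f u).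
  exists (g @^-1` Q'); first exact: open_subspace_preimage.
  by move=> _ [v Qv <-]; rewrite /preimage /= tensor_mapE; apply: Q'E; exists (g v).
Qed.

Lemma tensor_shriek_continuous :
  continuous (tensor_map f g : tensor_shriek U V -> tensor_shriek U' V').
Proof.
apply/(@linear_continuousP _ (tensor_shriek U V) (tensor_shriek U' V')) => E sE.
move=> /(lintop_openP sE) [_ [P [Q [oP oQ PQE]]]].
have tset0 (A : set U') (B : set V') : tensor_set A B 0.
  by exists [::]; rewrite ?big_nil.
have PE : tensor_set P [set: V'] `<=` E.
  by move=> x Px; apply: PQE; exists x => //; exists 0; rewrite ?addr0.
have QE : tensor_set [set: U'] Q `<=` E.
  by move=> y Qy; apply: PQE; exists 0 => //; exists y; rewrite ?add0r.
apply/lintop_openP; first exact: subspace_preimage.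
split; first exact: subspace_preimage.
exists (f @^-1` P), (g @^-1` Q); split; [exact: open_subspace_preimage..|].
move=> _ [x Px [y Qy <-]]; rewrite /preimage /= linearD.
apply: (subspaceD sE).
- exact: (@tensor_set_map P setT).
- exact: (@tensor_set_map setT Q).
Qed.

Definition tensor_star_map : hom (tensor_star U V) (tensor_star U' V') :=
  @Hom k (tensor_star U V) (tensor_star U' V') (tensor_map f g)
    tensor_star_continuous.
Definition tensor_arrow_map : hom (tensor_arrow U V) (tensor_arrow U' V') :=
  @Hom k (tensor_arrow U V) (tensor_arrow U' V') (tensor_map f g)
    tensor_arrow_continuous.
Definition tensor_shriek_map : hom (tensor_shriek U V) (tensor_shriek U' V') :=
  @Hom k (tensor_shriek U V) (tensor_shriek U' V') (tensor_map f g)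
    tensor_shriek_continuous.

End Maps.

Lemma tensor_map_id (U V : linTopType k) :
  tensor_map (hom_id U) (hom_id V) =1 id.
Proof.
apply: (@tensor_linear_ext k U V _ (tensor_map (hom_id U) (hom_id V)) idfun).
exact: (tensor_mapE (hom_id U) (hom_id V)).
Qed.

Lemma tensor_map_comp (U U' U'' V V' V'' : linTopType k)
    (f' : hom U' U'') (f : hom U U') (g' : hom V' V'') (g : hom V V') :
  tensor_map (hom_comp f' f) (hom_comp g' g) =1
  tensor_map f' g' \o tensor_map f g.
Proof.
apply: (@tensor_linear_ext k U V _ (tensor_map (hom_comp f' f) (hom_comp g' g))
  (tensor_map f' g' \o tensor_map f g)) => u v.
by rewrite [LHS]tensor_mapE [RHS]/= tensor_mapE [RHS]tensor_mapE.
Qed.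

Lemma tensor_star_map_id (U V : linTopType k) :
  tensor_star_map (hom_id U) (hom_id V) = hom_id (tensor_star U V).
Proof. by apply: homP; exact: tensor_map_id. Qed.

Lemma tensor_star_map_comp (U U' U'' V V' V'' : linTopType k)
    (f' : hom U' U'') (f : hom U U') (g' : hom V' V'') (g : hom V V') :
  tensor_star_map (hom_comp f' f) (hom_comp g' g) =
  hom_comp (tensor_star_map f' g') (tensor_star_map f g).
Proof. by apply: homP; exact: tensor_map_comp. Qed.

Definition star_functor : bifunctor k :=
  @Bifunctor k tensor_star tensor_star_map
    tensor_star_map_id tensor_star_map_comp.

Lemma tensor_arrow_map_id (U V : linTopType k) :
  tensor_arrow_map (hom_id U) (hom_id V) = hom_id (tensor_arrow U V).
Proof. by apply: homP; exact: tensor_map_id. Qed.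

Lemma tensor_arrow_map_comp (U U' U'' V V' V'' : linTopType k)
    (f' : hom U' U'') (f : hom U U') (g' : hom V' V'') (g : hom V V') :
  tensor_arrow_map (hom_comp f' f) (hom_comp g' g) =
  hom_comp (tensor_arrow_map f' g') (tensor_arrow_map f g).
Proof. by apply: homP; exact: tensor_map_comp. Qed.

Definition arrow_functor : bifunctor k :=
  @Bifunctor k tensor_arrow tensor_arrow_map
    tensor_arrow_map_id tensor_arrow_map_comp.

Lemma tensor_shriek_map_id (U V : linTopType k) :
  tensor_shriek_map (hom_id U) (hom_id V) = hom_id (tensor_shriek U V).
Proof. by apply: homP; exact: tensor_map_id. Qed.

Lemma tensor_shriek_map_comp (U U' U'' V V' V'' : linTopType k)
    (f' : hom U' U'') (f : hom U U') (g' : hom V' V'') (g : hom V V') :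
  tensor_shriek_map (hom_comp f' f) (hom_comp g' g) =
  hom_comp (tensor_shriek_map f' g') (tensor_shriek_map f g).
Proof. by apply: homP; exact: tensor_map_comp. Qed.

Definition shriek_functor : bifunctor k :=
  @Bifunctor k tensor_shriek tensor_shriek_map
    tensor_shriek_map_id tensor_shriek_map_comp.

End TensorTopologies.

Arguments star_functor k : clear implicits.
Arguments arrow_functor k : clear implicits.
Arguments shriek_functor k : clear implicits.

(* Main.v *)
From HB Require Import structures.
From mathcomp Require Import all_boot all_algebra all_classical topology.
Require Import Defs.

(** Kernels and cokernels of topological vector spaces are detected by probing
    their universal properties with a few spaces: the discrete line, the
    indiscrete line, and a space carrying an induced or a quotient topology.
    The outcome ([is_kernelP], [is_cokernelP]) is that a kernel of f is a
    topological embedding onto the vector space kernel of f, and a cokernel of f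
    is an open surjection whose vector space kernel is the range of f.  So it
    suffices to show that tensoring with a fixed space keeps three properties:
    exactness in the middle, being an open surjection, being an embedding.

    Over a field an exact pair (f, g) splits, id = f t + h g, and this identity
    survives tensoring; this settles exactness in the middle.  For open
    surjections, the image under f (x) g of an open subspace is open, since the
    subspaces witnessing its openness can be pushed forward.

    Embeddings are the heart of the matter.  An open subspace E of X (x) U has to
    be extended to an open subspace of X (x) V along an embedding j : U -> V.
    The extension is the preimage of E under a linear retraction S of
    id (x) j, so that the question is to choose S for which this preimage is
    open.  When all that matters is one open subspace Q of U, S = id (x) s works,
    where the retraction s of j carries some open subspace of V into Q
    ([embedding_retraction]).  For the products with exponents * and <- the
    subspaces Q_x with x (x) Q_x inside E depend on x, and there need not be a
    single s adapted to all of them.  There S is twisted: it maps x (x) v to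
    sigma x v, where sigma x is a retraction of j tensored with x that is adapted
    to Q_x, and where sigma x v = x (x) s v when x lies in a given open subspace
    ([twisted_retraction]).  With a basis of X one would choose sigma freely on
    the basis; here sigma comes from a uniformization theorem: a linear relation
    contains the graph of a linear function on its domain, and this function may
    be prescribed by a smaller single valued relation ([linear_uniformization]).
    All the linear algebra over a field that the proof uses, retractions,
    splittings and separating functionals, follows from it as well. *)

Set Implicit Arguments.
Unset Strict Implicit.
Unset Printing Implicit Defensive.

Import GRing.Theory.

Local Open Scope classical_set_scope.
Local Open Scope ring_scope.

(** * Uniformization of linear relations *)

Section Uniformization.
Variables (k : fieldType) (U W : lmodType k).
Implicit Types G H A : set (U * W).

Definition single_valued H : Prop := forall w, H (0, w) -> w = 0.

Lemma linear_exists (g : U -> W) : linear g -> exists h : {linear U -> W}, h =1 g.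
Proof.
move=> lg; pose L := GRing.isLinear.Build k U W *:%R g lg.
by exists (HB.pack g L : {linear U -> W}).
Qed.

Lemma single_valued_fun H u w w' : subspace_set H -> single_valued H ->
  H (u, w) -> H (u, w') -> w = w'.
Proof.
move=> sH vH Hw Hw'; apply/subr0_eq/vH.
rewrite -(subrr u); exact: (subspaceD sH Hw (subspaceN sH Hw')).
Qed.

(** Zorn's lemma, applied to the parts A of G that have not absorbed H yet, the
    condition being put on A together with H: in this form the empty chain is no
    exception.  A maximal relation has the domain of G, because a pair of G whose
    first component is outside the domain can be adjoined to it. *)
Lemma maximal_single_valued G H :
  subspace_set G -> subspace_set H -> H `<=` G -> single_valued H ->
  exists A, [/\ subspace_set A, H `<=` A, A `<=` G, single_valued A &
    forall u w, G (u, w) -> exists w', A (u, w')].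
Proof.
move=> sG sH HG vH.
pose P := [set B : set (U * W) |
  [/\ subspace_set (B `|` H), B `<=` G & single_valued (B `|` H)]].
have [F FP Ftot|A [[sA AG vA] Amax]] := @Zorn_bigcup (U * W)%type P.
  have FH x y : (\bigcup_(B in F) B `|` H) x -> (\bigcup_(B in F) B `|` H) y ->
      (H x /\ H y) \/ exists B, [/\ F B, (B `|` H) x & (B `|` H) y].
    move=> [[B FB Bx]|Hx] [[C FC Cy]|Hy]; last by left.
    - by have [BC|CB] := Ftot _ _ FB FC; right;
        [exists C|exists B]; split=> //; left => //; [exact: BC|exact: CB].
    - by right; exists B; split=> //; [left|right].
    - by right; exists C; split=> //; [right|left].
  split.
  - split; first by right; case: sH.
    move=> a x y xF yF; have [[Hx Hy]|[B [FB Bx By]]] := FH _ _ xF yF.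
      by right; case: sH => _; exact.
    have [[_ /(_ a x y Bx By) BH] _ _] := FP _ FB.
    by case: BH => [Bz|Hz]; [left; exists B|right].
  - by move=> x [B /FP [_ BG _]]; exact: BG.
  - move=> w [[B FB Bw]|Hw]; last exact: vH.
    by have [_ _ vB] := FP _ FB; apply: vB; left.
exists (A `|` H); split=> //.
  by move=> x [/AG|/HG].
move=> u w Guw; apply: contrapT => /forallNP nA.
(* The relation spanned by A, H and the new pair (u, w). *)
pose B := [set z | exists c, (A `|` H) (z - c *: (u, w))].
have AHB : A `|` H `<=` B by move=> z Az; exists 0; rewrite scale0r subr0.
have BH : B `|` H = B by apply/setUidl => x Hx; apply: AHB; right.
apply: (Amax B); [split|split; rewrite ?BH].
- by move=> x Ax; apply: AHB; left.
- move=> BA; apply: (nA w); left; apply: BA; exists 1; rewrite scale1r subrr.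
  exact: subspace0.
- split; first by apply: AHB; exact: subspace0.
  move=> a x y [c cx] [d dy]; exists (a * c + d).
  have -> : a *: x + y - (a * c + d) *: (u, w) =
      a *: (x - c *: (u, w)) + (y - d *: (u, w)).
    by rewrite scalerBr scalerA scalerDl opprD addrACA.
  by case: sA => _; exact.
- move=> z [c cz]; rewrite -(subrK (c *: (u, w)) z).
  apply: subspaceD => //; last exact: subspaceZ.
  by case: cz => [/AG|/HG].
(* If (0, w') lies in B through a coefficient c != 0, then u is already in the
   domain. *)
- move=> w' [c]; have [->|c0] := eqVneq c 0; first by rewrite scale0r subr0 => /vA.
  move=> /(subspaceZ (- c^-1) sA); rewrite scaleNr -scalerN opprB scalerBr scalerA.
  rewrite mulVf // scale1r => AH; exfalso; apply: (nA (w - c^-1 *: w')).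
  have <- // : (u, w) - c^-1 *: (0, w') = (u, w - c^-1 *: w').
  by rewrite -[in RHS](subr0 u) -[in RHS](scaler0 _ c^-1).
Qed.

Lemma linear_of_relation A : subspace_set A -> single_valued A ->
  (forall u, exists w, A (u, w)) -> exists g : {linear U -> W}, forall u, A (u, g u).
Proof.
move=> sA vA /choice [g Ag].
have [|h hg] := @linear_exists g; last by exists h => u; rewrite hg.
move=> a x y; apply: (single_valued_fun sA vA (Ag _)).
by have [_ /(_ a _ _ (Ag x) (Ag y))] := sA.
Qed.

(** Two steps, as the domain of G may be a proper subspace: first a single valued
    relation between H and G with the domain of G, then an arbitrary extension of
    it to all of U. *)
Lemma linear_uniformization G H :
  subspace_set G -> subspace_set H -> H `<=` G -> single_valued H ->
  exists g : {linear U -> W},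
    (forall u w, G (u, w) -> G (u, g u)) /\ (forall u w, H (u, w) -> g u = w).
Proof.
move=> sG sH HG vH.
have [A [sA HA AG vA domA]] := maximal_single_valued sG sH HG vH.
have [B [sB AB _ vB domB]] :=
  maximal_single_valued (@subspaceT k (U * W)%type) sA (@subsetT _ A) vA.
have [u|g Bg] := linear_of_relation sB vB; first exact: (domB u 0).
have gE u w : A (u, w) -> g u = w.
  by move=> /AB; exact: (single_valued_fun sB vB (Bg u)).
exists g; split=> u w; last by move=> /HA /gE.
by move=> /domA [w' Aw']; rewrite (gE _ _ Aw'); exact: AG.
Qed.

Lemma linear_extension H : subspace_set H -> single_valued H ->
  exists g : {linear U -> W}, forall u w, H (u, w) -> g u = w.
Proof.
move=> sH vH.
by have [g [_ gH]] :=
  linear_uniformization (@subspaceT k (U * W)%type) sH (@subsetT _ H) vH; exists g.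
Qed.

Lemma linear_selection G : subspace_set G ->
  exists g : {linear U -> W}, forall u w, G (u, w) -> G (u, g u).
Proof.
move=> sG; have [|||g [gG _]] := @linear_uniformization G [set 0] sG.
- by split=> // a x y -> ->; rewrite scaler0 addr0.
- by move=> _ ->; exact: subspace0.
- by move=> w [].
by exists g.
Qed.

End Uniformization.

(** * Linear algebra *)

Section LinearAlgebra.
Variable k : fieldType.
Implicit Types U V W : lmodType k.

(** The functional maps e + a *: c to a on the span of E and c. *)
Lemma separating_functional V (E : set V) c : subspace_set E -> ~ E c ->
  exists phi : {linear V -> k^o}, (forall e, E e -> phi e = 0) /\ phi c = 1.
Proof.
move=> sE nEc.
have [||phi phiE] := @linear_extension k V k^o [set z | E (z.1 - z.2 *: c)].
- split=> [|a x y Ex Ey]; first by rewrite /= scale0r subr0; exact: subspace0.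
  rewrite /= scalerDl opprD addrACA -[(a *: x.2) *: c]scalerA -scalerBr.
  by case: sE => _; exact.
- move=> a /=; rewrite sub0r => /(subspaceN sE); rewrite opprK => Eac.
  have [//|a0] := eqVneq a 0; case: nEc.
  by have := subspaceZ a^-1 sE Eac; rewrite scalerA mulVf // scale1r.
exists phi; split=> [e Ee|]; apply: phiE => /=; first by rewrite scale0r subr0.
by rewrite scale1r subrr; exact: subspace0.
Qed.

(** The map h is a generalized inverse of b, that is, b h b = b.  Hence
    v - h (b v) lies in ker b, and t selects preimages of these vectors by a. *)
Lemma split_exact U V W (a : {linear U -> V}) (b : {linear V -> W}) :
  (forall v, b v = 0 -> exists u, v = a u) ->
  exists (t : {linear V -> U}) (h : {linear W -> V}),
    forall v, v = a (t v) + h (b v).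
Proof.
move=> ex.
have [|h hb] := @linear_selection k W V [set z | z.1 = b z.2].
  by split=> [|c x y /= -> ->]; rewrite /= ?linear0 // linearP.
have {}hb v : b v = b (h (b v)) := hb (b v) v erefl.
have [|t ta] := @linear_selection k V U [set z | z.1 - h (b z.1) = a z.2].
  split=> [|c x y /= xE yE]; first by rewrite /= !linear0 addr0.
  rewrite (linearP b) (linearP h) (linearP a) -xE -yE.
  by rewrite scalerBr opprD addrACA.
exists t, h => v; have [|u vE] := ex (v - h (b v)).
  by rewrite linearB -hb subrr.
by have := ta v u vE => /= <-; rewrite subrK.
Qed.

(** A retraction of i that induces a map V / P -> U / (i^-1 P).  It is constructed
    first on P, and then extended from i U + P to V; the two prescriptions agree
    on the intersection of i U and P. *)
Lemma adapted_retraction U V (i : {linear U -> V}) (P : set V) :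
  injective i -> subspace_set P ->
  exists r : {linear V -> U}, cancel i r /\ forall p, P p -> P (i (r p)).
Proof.
move=> inj_i sP.
have i0 u : i u = 0 -> u = 0 by move=> iu; apply: inj_i; rewrite iu linear0.
(* A map r1 that sends P into i^-1 P and inverts i over P. *)
have [||||r1 [r1P r1i]] := @linear_uniformization k V U
  [set z | P z.1 /\ P (i z.2)] [set z | z.1 = i z.2 /\ P (i z.2)].
- split=> [|c x y [Px ix] [Py iy]].
    by rewrite /= linear0; split; exact: subspace0.
  by rewrite /= linearP; case: sP => _ H; split; apply: H.
- split=> [|c x y /= [-> ix] [-> iy]].
    by rewrite /= linear0; split=> //; exact: subspace0.
  by rewrite linearP; split=> //; case: sP => _; exact.
- by move=> z /= [->].
- by move=> w /= [/esym /i0].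
have {}r1P p : P p -> P (i (r1 p)).
  move=> Pp; have [//|_ //] := r1P p 0; split=> //=.
  by rewrite linear0; exact: subspace0.
have {}r1i u : P (i u) -> r1 (i u) = u by move=> Pu; apply: r1i.
have [||r rE] := @linear_extension k V U
  [set z | exists u p, [/\ P p, z.1 = i u + p & z.2 = u + r1 p]].
- split=> [|c [_ _] [_ _] [u [p [Pp /= -> ->]]] [u' [p' [Pp' /= -> ->]]]].
    by exists 0, 0; rewrite /= !linear0 !addr0; split=> //; exact: subspace0.
  exists (c *: u + u'), (c *: p + p').
  rewrite (linearP i) (linearP r1) !scalerDr; split; [|by rewrite addrACA..].
  by case: sP => _; exact.
- move=> w [u [p [Pp /= /esym/eqP]]]; rewrite addrC addr_eq0 => /eqP pE ->.
  rewrite pE linearN r1i ?subrr //.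
  by rewrite -[i u]opprK -pE; exact: subspaceN.
exists r; split=> [u|p Pp].
  apply: rE; exists u, 0; rewrite /= !linear0 !addr0; split=> //; exact: subspace0.
have -> : r p = r1 p by apply: rE; exists 0, p; rewrite /= linear0 !add0r.
exact: r1P.
Qed.

End LinearAlgebra.

(** * Kernels and cokernels of topological vector spaces *)

Section KernelsCokernels.
Variable k : fieldType.
Implicit Types U V W T : linTopType k.

Lemma open_subspaceS V (E F : set V) :
  open_subspace E -> subspace_set F -> E `<=` F -> open_subspace F.
Proof.
move=> [sE oE] sF EF; split=> //; apply/subspace_openP => //.
by apply: filterS EF _; exact/subspace_openP.
Qed.

Lemma lintop_open_subspaceP (V : lmodType k) (B : subspace_filter V)
  (E : set (lintop B)) : open_subspace E <-> B E.
Proof.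
split=> [[sE oE]|BE]; first exact/(@lintop_openP _ _ B E sE).
have sE := sf_subspace BE; split=> //; exact/(@lintop_openP _ _ B E sE).
Qed.

Lemma hom_exists U V (g : U -> V) : linear g ->
  (forall E : set V, open_subspace E ->
    exists2 E' : set U, open_subspace E' & E' `<=` g @^-1` E) ->
  exists h : hom U V, h =1 g.
Proof.
move=> /linear_exists [l lg] og; rewrite -(funext lg) in og *.
have cl : continuous l.
  apply/linear_continuousP => E sE oE; have [//|E' oE' E'E] := og E.
  by have [] := open_subspaceS oE' (subspace_preimage l sE) E'E.
by exists (Hom cl).
Qed.

Lemma hom_congr U V (f g : hom U V) : f = g -> f =1 g.
Proof. by move=> ->. Qed.

Definition exact_at U V W (f : hom U V) (g : hom V W) : Prop :=
  forall v, g v = 0 <-> exists u, v = f u.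

(** Every open subspace contains the trace of an open subspace of V: this says
    that the topology of U is the one induced from V. *)
Definition embedding U V (i : hom U V) : Prop :=
  injective i /\ forall E : set U, open_subspace E ->
    exists2 E' : set V, open_subspace E' & i @^-1` E' `<=` E.

(** Linear quotient maps are open, and the open subspaces suffice to test this. *)
Definition quotient_map U V (p : hom U V) : Prop :=
  (forall v, exists u, v = p u) /\
  forall E : set U, open_subspace E -> open_subspace (p @` E).

Section LineTopologies.
Variable V : lmodType k.

Let discrete_setI (E F : set V) :
  subspace_set E -> subspace_set F -> subspace_set (E `&` F).
Proof. exact: subspaceI. Qed.

(** The line with this topology represents the forgetful functor to vector spaces:
    morphisms from it to a space are the vectors of that space. *)
Definition discrete_filter : subspace_filter V :=
  @SubspaceFilter k V (@subspace_set k V) (fun _ => id) (@subspaceT k V)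
    discrete_setI (fun _ _ sF _ _ => sF).

Let indiscrete_subspace (E : set V) : E = setT -> subspace_set E.
Proof. by move=> ->; exact: subspaceT. Qed.

Let indiscrete_setI (E F : set V) : E = setT -> F = setT -> E `&` F = setT.
Proof. by move=> -> ->; rewrite setIT. Qed.

Let indiscrete_up (E F : set V) :
  subspace_set F -> E `<=` F -> E = setT -> F = setT.
Proof. by move=> _ EF ET; rewrite -subTset -ET. Qed.

(** With this topology all linear maps into V are continuous. *)
Definition indiscrete_filter : subspace_filter V :=
  @SubspaceFilter k V (fun E => E = setT) indiscrete_subspace erefl
    indiscrete_setI indiscrete_up.

End LineTopologies.

Section Induced.
Variables (U V : linTopType k) (f : hom U V).

Let induced_open (E : set U) : Prop :=
  subspace_set E /\ exists2 E' : set V, open_subspace E' & f @^-1` E' `<=` E.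

Let induced_setT : induced_open setT.
Proof. by split=> //; exists setT => //; exact: open_subspaceT. Qed.

Let induced_setI E F : induced_open E -> induced_open F -> induced_open (E `&` F).
Proof.
move=> [sE [E' oE' EE']] [sF [F' oF' FF']]; split; first exact: subspaceI.
by exists (E' `&` F') => [|x [/EE' ? /FF']] //; exact: open_subspaceI.
Qed.

Let induced_up E F : subspace_set F -> E `<=` F -> induced_open E -> induced_open F.
Proof. by move=> sF EF [_ [E' oE' EE']]; split=> //; exists E' => // x /EE' /EF. Qed.

Definition induced_filter : subspace_filter U :=
  @SubspaceFilter k U induced_open (fun _ => @proj1 _ _)
    induced_setT induced_setI induced_up.

Let final_open (E : set V) : Prop := subspace_set E /\ open (f @^-1` E).

Let final_setT : final_open setT.
Proof. by split=> //; exact: openT. Qed.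

Let final_setI E F : final_open E -> final_open F -> final_open (E `&` F).
Proof.
by move=> [sE oE] [sF oF]; split; [exact: subspaceI|rewrite preimage_setI; exact: openI].
Qed.

Let final_up E F : subspace_set F -> E `<=` F -> final_open E -> final_open F.
Proof.
move=> sF EF [sE oE]; split=> //.
have : open_subspace (f @^-1` F); last by case.
by apply: (@open_subspaceS _ (f @^-1` E)); [split|..] => //;
  [exact: subspace_preimage..|move=> x /EF].
Qed.

Definition final_filter : subspace_filter V :=
  @SubspaceFilter k V final_open (fun _ => @proj1 _ _)
    final_setT final_setI final_up.

End Induced.

Lemma line_hom V (v : V) : exists g : hom (lintop (discrete_filter k^o)) V,
  forall a : k, g a = a *: v.
Proof.
apply: (@hom_exists (lintop (discrete_filter k^o)) V (fun a : k => a *: v)).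
  by move=> a b c; rewrite scalerDl -scalerA.
move=> E [sE oE]; exists [set 0].
  apply/lintop_open_subspaceP; split=> // a b c -> ->.
  by rewrite scaler0 addr0.
by move=> a ->; rewrite /preimage /= scale0r; exact: subspace0.
Qed.

Lemma functional_hom V (phi : {linear V -> k^o}) :
  exists g : hom V (lintop (indiscrete_filter k^o)), g =1 phi.
Proof.
apply: (@hom_exists V (lintop (indiscrete_filter k^o)) phi).
  exact: linearP.
move=> E /lintop_open_subspaceP ->; rewrite preimage_setT.
by exists setT => //; exact: open_subspaceT.
Qed.

(** Maps from the discrete line into a kernel of f are the vectors of the kernel,
    which yields injectivity and exactness.  For the topology, the universal
    property is applied to K with the topology induced by i: the factorization
    of i through K is the identity, and it is continuous. *)
Lemma is_kernelP K U V (i : hom K U) (f : hom U V) :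
  is_kernel i f <-> embedding i /\ exact_at i f.
Proof.
split=> [[fi0 ker]|[[inj_i top_i] ex]].
  have fi x : f (i x) = 0 := hom_congr fi0 x.
  have inj_i : injective i.
    move=> x y ixy; have [g gE] := line_hom x; have [h hE] := line_hom y.
    have [|s [_ su]] := ker _ (hom_comp i g).
      by apply: homP => a; rewrite /= fi.
    have gh : g = h.
      rewrite -(su g erefl); apply: su.
      by apply: homP => a; rewrite /= gE hE !linearZ_LR ixy.
    by rewrite -[x]scale1r -gE gh hE scale1r.
  split; last first.
    move=> u; split=> [fu|[x ->] //]; have [g gE] := line_hom u.
    have [|s [/hom_congr/(_ 1) /= su _]] := ker _ g.
      by apply: homP => a; rewrite /= gE linearZ_LR fu scaler0.
    by exists (s 1); rewrite su gE scale1r.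
  split=> // E oE; pose T : linTopType k := lintop (induced_filter i).
  have [||t tE] := @hom_exists T U i; first exact: linearP.
    move=> E' oE'; exists (i @^-1` E') => //.
    apply/lintop_open_subspaceP; split; last by exists E'.
    by case: oE' => sE' _; exact: subspace_preimage.
  have [|s [/hom_congr is_ _]] := ker T t; first by apply: homP => x; rewrite /= tE.
  have {}is_ : s = id :> (K -> K).
    by apply/funext => x; apply: inj_i; rewrite [LHS]is_ tE.
  have := open_subspace_preimage s oE; rewrite is_ preimage_id.
  by move/lintop_open_subspaceP => [].
split; first by apply: homP => x; apply/ex; exists x.
move=> T t ft; have /choice [s sE] : forall x, exists y, t x = i y.
  by move=> x; apply/ex; exact: (hom_congr ft x).
have [||h hs] := @hom_exists T K s.
- by move=> a x y; apply: inj_i; rewrite -sE !linearP !sE.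
- move=> E /top_i [E' oE' E'E].
  exists (t @^-1` E'); first exact: open_subspace_preimage.
  by move=> x E'x; apply: E'E; rewrite /preimage /= -sE.
exists h; split; first by apply: homP => x; rewrite /= hs sE.
by move=> h' h't; apply: homP => x; apply: inj_i; rewrite hs -sE -h't.
Qed.

Lemma subspace_image (U V : lmodType k) (f : {linear U -> V}) (E : set U) :
  subspace_set E -> subspace_set (f @` E).
Proof.
move=> [E0 EP]; split=> [|a _ _ [x Ex <-] [y Ey <-]].
  by exists 0; rewrite ?linear0.
by exists (a *: x + y); rewrite ?linearP //; exact: EP.
Qed.

(** A vector outside the range of p, or outside the range of f, is separated from
    it by a linear functional, which is continuous into the indiscrete line; the
    uniqueness of factorizations then gives surjectivity, and their existence
    gives exactness.  For the topology, the universal property is applied to C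
    with the finest topology that makes p continuous. *)
Lemma is_cokernelP U V C (p : hom V C) (f : hom U V) :
  is_cokernel p f <-> quotient_map p /\ exact_at f p.
Proof.
split=> [[pf0 coker]|[[surj_p open_p] ex]].
  have pf x : p (f x) = 0 := hom_congr pf0 x.
  have surj_p c : exists v, c = p v.
    apply: contrapT => nc.
    have [|//|phi [phi0 phic]] := @separating_functional k C (range p) c.
    - exact/subspace_image/subspaceT.
    - by case=> v _ pv; apply: nc; exists v.
    have [g gE] := functional_hom phi.
    have gp0 : hom_comp g p = hom_zero V (lintop (indiscrete_filter k^o)).
      by apply: homP => v; rewrite /= gE phi0 //; exists v.
    have [|s [_ su]] := coker _ (hom_comp g p).
      by apply: homP => u; rewrite /= pf linear0.
    have sg := su g erefl.
    have s0 : s = hom_zero C (lintop (indiscrete_filter k^o)).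
      by apply: su; rewrite gp0; apply: homP.
    have := gE c; rewrite phic -sg s0 /= => /esym/eqP.
    by rewrite oner_eq0.
  split; last first.
    move=> v; split=> [pv|[u ->] //]; apply: contrapT => nv.
    have [||phi [phi0 phiv]] := @separating_functional k V (range f) v.
    - exact/subspace_image/subspaceT.
    - by case=> u _ fu; apply: nv; exists u.
    have [g gE] := functional_hom phi.
    have [|s [/hom_congr/(_ v) sp _]] := coker _ g.
      by apply: homP => u; rewrite /= gE phi0 //; exists u.
    move: sp; rewrite gE phiv /= pv linear0 => /esym/eqP.
    by rewrite oner_eq0.
  split=> // E oE; pose T : linTopType k := lintop (final_filter p).
  have [||t tE] := @hom_exists V T p; first exact: linearP.
    move=> E' /lintop_open_subspaceP [sE' oE']; exists (p @^-1` E') => //.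
    by split=> //; exact: subspace_preimage.
  have [|s [/hom_congr sp _]] := coker T t; first by apply: homP => x; rewrite /= tE.
  have {}sp : s = id :> (C -> C).
    apply/funext => c; have [v ->] := surj_p c; by rewrite [LHS]sp tE.
  have : open_subspace (p @` E : set T).
    apply/lintop_open_subspaceP; have spE := subspace_image p oE.1; split=> //.
    have : open_subspace (p @^-1` (p @` E)); last by case.
    apply: open_subspaceS oE (subspace_preimage p spE) _.
    exact: preimage_image.
  by move=> /(open_subspace_preimage s); rewrite sp preimage_id.
split; first by apply: homP => u; apply/ex; exists u.
move=> T t tf; have /choice [q qE] := surj_p.
have tq v : t (q (p v)) = t v.
  apply/subr0_eq; rewrite -linearB.
  have /ex [u ->] : p (q (p v) - v) = 0 by rewrite linearB -qE subrr.
  exact: (hom_congr tf u).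
have [||h hE] := @hom_exists C T (t \o q).
- move=> a x y; rewrite /= -linearP -[RHS]tq; congr (t (q _)).
  by rewrite linearP -!qE.
- move=> E oE; exists (p @` (t @^-1` E)).
    by apply: open_p; exact: open_subspace_preimage.
  by move=> _ [v Ev <-]; rewrite /preimage /= tq.
exists h; split; first by apply: homP => v; rewrite /= hE /= tq.
by move=> h' h't; apply: homP => c; rewrite hE /= -h't /= -qE.
Qed.

End KernelsCokernels.

(** * A criterion of exactness *)

Section Criterion.
Variable k : fieldType.

Lemma exactness_criterion (F : endofunctor k) : additive_functor F ->
  (forall (U V : linTopType k) (i : hom U V), embedding i -> embedding (fmap F i)) ->
  (forall (U V : linTopType k) (p : hom U V),
     quotient_map p -> quotient_map (fmap F p)) ->
  (forall (U V W : linTopType k) (f : hom U V) (g : hom V W),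
     exact_at f g -> exact_at (fmap F f) (fmap F g)) ->
  [/\ preserves_kernels F, preserves_cokernels F & exact_functor F].
Proof.
move=> addF embF quotF exF.
have kerF : preserves_kernels F.
  by move=> K U V i f /is_kernelP [/embF ? /exF ?]; apply/is_kernelP.
have cokF : preserves_cokernels F.
  by move=> U V C p f /is_cokernelP [/quotF ? /exF ?]; apply/is_cokernelP.
split=> //; split=> // A' A A'' i p [ker coker].
by split; [exact: kerF|exact: cokF].
Qed.

Lemma bifunctor_exactness (F : bifunctor k) :
  (forall X, let P G := [/\ preserves_kernels G, preserves_cokernels G
     & exact_functor G] in P (fix_left F X) /\ P (fix_right F X)) ->
  [/\ in_each_argument (@preserves_kernels k) F,
      in_each_argument (@preserves_cokernels k) F
    & in_each_argument (@exact_functor k) F].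
Proof. by move=> FP; split=> X; have [[? ? ?] [? ? ?]] := FP X. Qed.

(** The preimage of E under a retraction of f extends E to V.  The retraction may
    depend on E: this freedom is what makes the twisted retractions below
    possible. *)
Lemma embedding_of_retractions (U V : linTopType k) (f : hom U V) :
  (forall E : set U, open_subspace E -> exists r : {linear V -> U},
    cancel f r /\ open_subspace (r @^-1` E)) ->
  embedding f.
Proof.
move=> fP; split=> [|E /fP [r [fr oE]]].
  by have [r [/can_inj]] := fP setT (open_subspaceT _).
by exists (r @^-1` E) => // u; rewrite /preimage /= fr.
Qed.

Lemma embedding_id (U : linTopType k) : embedding (hom_id U).
Proof. by split=> [|E oE] //; exists E. Qed.

Lemma quotient_map_id (U : linTopType k) : quotient_map (hom_id U).
Proof. by split=> [u|E]; [exists u|rewrite image_id]. Qed.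

Lemma embedding_retraction (U V : linTopType k) (i : hom U V) (E : set U) :
  embedding i -> open_subspace E -> exists (r : {linear V -> U}) (E' : set V),
    [/\ cancel i r, open_subspace E' & forall e, E' e -> E (r e)].
Proof.
move=> [inj_i top_i] /top_i [E' oE' E'E].
have [r [ir rE']] := adapted_retraction inj_i oE'.1.
by exists r, E'; split=> // e /rE' /E'E.
Qed.

End Criterion.

(** * Tensor products of linear maps *)

Section TensorLinear.
Variable k : fieldType.
Implicit Types U V W X : lmodType k.

Lemma tensor_subspace_full U V (E : set (tensor U V)) : subspace_set E ->
  (forall u v, E (tens u v)) -> forall x, E x.
Proof. by move=> sE Et x; have [s ->] := tensorP x; exact: subspace_sum. Qed.

Lemma tensDl U V (u u' : U) (v : V) : tens (u + u') v = tens u v + tens u' v.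
Proof. by have := tens_linearl v 1 u u'; rewrite !scale1r. Qed.

Lemma tensDr U V (u : U) (v v' : V) : tens u (v + v') = tens u v + tens u v'.
Proof. by have := tens_linearr u 1 v v'; rewrite !scale1r. Qed.

Lemma tens0l U V (v : V) : tens (0 : U) v = 0.
Proof. by apply: (addrI (tens 0 v)); rewrite -tensDl !addr0. Qed.

Lemma tens0r U V (u : U) : tens u (0 : V) = 0.
Proof. by apply: (addrI (tens u 0)); rewrite -tensDr !addr0. Qed.

(** A splitting passes to tensor products.  Maps act on both factors so that the
    statement can be used with the identity on either side. *)
Lemma tensor_map_exact U V W U' V' W'
    (f : {linear U -> V}) (g : {linear V -> W})
    (f' : {linear U' -> V'}) (g' : {linear V' -> W'})
    (t : {linear V -> U}) (h : {linear W -> V})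
    (t' : {linear V' -> U'}) (h' : {linear W' -> V'}) :
  (forall u u', tens (g (f u)) (g' (f' u')) = 0) ->
  (forall v v', tens v v' = tens (f (t v)) (f' (t' v')) + tens (h (g v)) (h' (g' v'))) ->
  forall x, tensor_map g g' x = 0 <-> exists y, x = tensor_map f f' y.
Proof.
move=> gf0 id_split x; split=> [gx|[y ->]].
  exists (tensor_map t t' x).
  have E := @tensor_linear_ext _ _ _ _ (idfun : {linear tensor V V' -> tensor V V'})
    ((tensor_map f f' \o tensor_map t t') \+ (tensor_map h h' \o tensor_map g g')).
  rewrite [LHS]E /= ?gx ?linear0 ?addr0 // => u v.
  by rewrite /= !tensor_mapE -id_split.
have E := @tensor_linear_ext _ _ _ _ (tensor_map g g' \o tensor_map f f') \0.
by apply: E => u v /=; rewrite !tensor_mapE.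
Qed.

End TensorLinear.


Section TensorExact.
Variables (k : fieldType) (X U V W : linTopType k) (f : hom U V) (g : hom V W).

Lemma tensor_map_exactr : exact_at f g ->
  forall x, tensor_map (hom_id X) g x = 0 <->
    exists y, x = tensor_map (hom_id X) f y.
Proof.
move=> ex; have [|t [h th]] := @split_exact _ _ _ _ f g; first by move=> v /ex.
apply: (tensor_map_exact (t := idfun) (h := idfun) (t' := t) (h' := h)) => [x u|x v] /=.
  have -> : g (f u) = 0 by apply/ex; exists u.
  exact: tens0r.
by rewrite -tensDr -th.
Qed.

Lemma tensor_map_exactl : exact_at f g ->
  forall x, tensor_map g (hom_id X) x = 0 <->
    exists y, x = tensor_map f (hom_id X) y.
Proof.
move=> ex; have [|t [h th]] := @split_exact _ _ _ _ f g; first by move=> v /ex.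
apply: (tensor_map_exact (t := t) (h := h) (t' := idfun) (h' := idfun)) => [u x|v x] /=.
  have -> : g (f u) = 0 by apply/ex; exists u.
  exact: tens0l.
by rewrite -tensDl -th.
Qed.

End TensorExact.

(** * The topologies on the tensor product *)

Section TensorOpen.
Variable k : fieldType.

Section Criteria.
Variables U V : linTopType k.
Implicit Types E : set (tensor U V).

Lemma star_openP E : open_subspace (E : set (tensor_star U V)) <->
  [/\ subspace_set E,
      exists (P : set U) (Q : set V), [/\ open_subspace P, open_subspace Q &
        forall u v, P u -> Q v -> E (tens u v)],
      forall u, exists2 Q : set V, open_subspace Q & forall v, Q v -> E (tens u v)
    & forall v, exists2 P : set U, open_subspace P & forall u, P u -> E (tens u v)].
Proof.
apply: (iff_trans (@lintop_open_subspaceP _ _ (star_filter U V) E)); split.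
  case=> sE [P [Q [oP oQ /(tensor_set_subP _ _ sE) PQE]]] El Er; split=> //.
  - by exists P, Q.
  - by move=> u; have [Q' oQ' QE] := El u; exists Q' => // v Qv; apply: QE; exists v.
  - by move=> v; have [P' oP' PE] := Er v; exists P' => // u Pu; apply: PE; exists u.
case=> sE [P [Q [oP oQ PQE]]] El Er; split=> //.
- by exists P, Q; split=> //; exact/tensor_set_subP.
- by move=> u; have [Q' oQ' QE] := El u; exists Q' => // _ [v Qv <-]; exact: QE.
- by move=> v; have [P' oP' PE] := Er v; exists P' => // _ [u Pu <-]; exact: PE.
Qed.

Lemma arrow_openP E : open_subspace (E : set (tensor_arrow U V)) <->
  [/\ subspace_set E,
      exists2 P : set U, open_subspace P & forall u v, P u -> E (tens u v)
    & forall u, exists2 Q : set V, open_subspace Q & forall v, Q v -> E (tens u v)].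
Proof.
apply: (iff_trans (@lintop_open_subspaceP _ _ (arrow_filter U V) E)); split.
  case=> sE [P oP /(tensor_set_subP _ _ sE) PE] El; split=> //.
  - by exists P => // u v Pu; exact: PE.
  - by move=> u; have [Q' oQ' QE] := El u; exists Q' => // v Qv; apply: QE; exists v.
case=> sE [P oP PE] El; split=> //.
- by exists P => //; apply/tensor_set_subP => // u v Pu _; exact: PE.
- by move=> u; have [Q' oQ' QE] := El u; exists Q' => // _ [v Qv <-]; exact: QE.
Qed.

Lemma shriek_openP E : open_subspace (E : set (tensor_shriek U V)) <->
  subspace_set E /\
  exists (P : set U) (Q : set V), [/\ open_subspace P, open_subspace Q,
    forall u v, P u -> E (tens u v) & forall u v, Q v -> E (tens u v)].
Proof.
have ts (A : set U) (B : set V) u v : A u -> B v -> tensor_set A B (tens u v).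
  by move=> Au Bv; exists [:: (u, v)]; rewrite ?big_seq1 // => z /[!inE]/eqP->.
apply: (iff_trans (@lintop_open_subspaceP _ _ (shriek_filter U V) E)).
split=> -[sE [P [Q]]].
  move=> [oP oQ PQE]; split=> //; exists P, Q; split=> // u v uv; apply: PQE.
  - exists (tens u v); first exact: ts.
    by exists (tens u 0); rewrite ?tens0r ?addr0 // -(tens0r _ u);
      apply: ts => //; case: oQ => /subspace0.
  - exists (tens 0 v); first by apply: ts => //; case: oP => /subspace0.
    by exists (tens u v); [exact: ts|rewrite tens0l add0r].
move=> [oP oQ PE QE]; split=> //; exists P, Q; split=> // _ [x Px [y Qy <-]].
apply: subspaceD => //.
  by move: x Px; apply/tensor_set_subP => // u v Pu _; exact: PE.
by move: y Qy; apply/tensor_set_subP => // u v _; exact: QE.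
Qed.

End Criteria.
Section Maps.
Variables (U U' V V' : linTopType k) (f : hom U U') (g : hom V V').

Lemma tensor_map_surjective : quotient_map f -> quotient_map g ->
  forall x, exists y, x = tensor_map f g y.
Proof.
move=> [sf _] [sg _] x; have [] // : range (tensor_map f g) x.
  apply: tensor_subspace_full x; first exact/subspace_image/subspaceT.
  move=> u' v'; have [u ->] := sf u'; have [v ->] := sg v'.
  by exists (tens u v) => //; exact: tensor_mapE.
by move=> y _ <-; exists y.
Qed.

Lemma image_tens (E : set (tensor U V)) u v :
  E (tens u v) -> (tensor_map f g @` E) (tens (f u) (g v)).
Proof. by move=> Euv; exists (tens u v) => //; exact: tensor_mapE. Qed.

Lemma star_quotient_map :
  quotient_map f -> quotient_map g -> quotient_map (tensor_star_map f g).
Proof.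
move=> qf qg; split=> [|E]; first exact: tensor_map_surjective.
have [[sf opf] [sg opg]] := (qf, qg).
move=> /star_openP [sE [P [Q [oP oQ PQE]]] El Er]; apply/star_openP; split.
- exact: subspace_image.
- exists (f @` P), (g @` Q); split; [exact: opf|exact: opg|].
  by move=> _ _ [u Pu <-] [v Qv <-]; apply/image_tens/PQE.
- move=> u'; have [u ->] := sf u'; have [Q' oQ' Q'E] := El u.
  by exists (g @` Q') => [|_ [v Qv <-]]; [exact: opg|apply/image_tens/Q'E].
- move=> v'; have [v ->] := sg v'; have [P' oP' P'E] := Er v.
  by exists (f @` P') => [|_ [u Pu <-]]; [exact: opf|apply/image_tens/P'E].
Qed.

Lemma arrow_quotient_map :
  quotient_map f -> quotient_map g -> quotient_map (tensor_arrow_map f g).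
Proof.
move=> qf qg; split=> [|E]; first exact: tensor_map_surjective.
have [[sf opf] [sg opg]] := (qf, qg).
move=> /arrow_openP [sE [P oP PE] El]; apply/arrow_openP; split.
- exact: subspace_image.
- exists (f @` P) => [|_ v' [u Pu <-]]; first exact: opf.
  by have [v ->] := sg v'; apply/image_tens/PE.
- move=> u'; have [u ->] := sf u'; have [Q' oQ' Q'E] := El u.
  by exists (g @` Q') => [|_ [v Qv <-]]; [exact: opg|apply/image_tens/Q'E].
Qed.

Lemma shriek_quotient_map :
  quotient_map f -> quotient_map g -> quotient_map (tensor_shriek_map f g).
Proof.
move=> qf qg; split=> [|E]; first exact: tensor_map_surjective.
have [[sf opf] [sg opg]] := (qf, qg).
move=> /shriek_openP [sE [P [Q [oP oQ PE QE]]]]; apply/shriek_openP; split.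
  exact: subspace_image.
exists (f @` P), (g @` Q); split; [exact: opf|exact: opg| |].
- by move=> _ v' [u Pu <-]; have [v ->] := sg v'; apply/image_tens/PE.
- by move=> u' _ [v Qv <-]; have [u ->] := sf u'; apply/image_tens/QE.
Qed.

Lemma tensor_mapK (r : {linear U' -> U}) (s : {linear V' -> V}) :
  cancel f r -> cancel g s -> cancel (tensor_map f g) (tensor_map r s).
Proof.
move=> fr gs.
have E := @tensor_linear_ext _ _ _ _ (tensor_map r s \o tensor_map f g) idfun.
by apply: E => u v /=; rewrite !tensor_mapE fr gs.
Qed.

(** A neighborhood in this topology is controlled by one open subspace on each
    side, so a tensor product of adapted retractions will do. *)
Lemma shriek_embedding :
  embedding f -> embedding g -> embedding (tensor_shriek_map f g).
Proof.
move=> ef eg; apply: embedding_of_retractions => E.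
move=> /shriek_openP [sE [P [Q [oP oQ PE QE]]]].
have [r [P' [fr oP' rP]]] := embedding_retraction ef oP.
have [s [Q' [gs oQ' sQ]]] := embedding_retraction eg oQ.
exists (tensor_map r s); split; first exact: tensor_mapK.
apply/shriek_openP; split; first exact: subspace_preimage.
exists P', Q'; split=> // u v uv; rewrite /preimage /= tensor_mapE.
  by apply/PE/rP.
by apply/QE/sQ.
Qed.

End Maps.

(** The retraction of i only has to be adapted to P, as the subspace of X
    that belongs to a vector u is taken to be the one that belongs to r u. *)
Lemma arrow_embeddingl (X U V : linTopType k) (i : hom U V) :
  embedding i -> embedding (tensor_arrow_map i (hom_id X)).
Proof.
move=> ei; apply: embedding_of_retractions => E /arrow_openP [sE [P oP PE] El].
have [r [P' [ir oP' rP]]] := embedding_retraction ei oP.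
exists (tensor_map r idfun); split; first exact: tensor_mapK.
apply/arrow_openP; split; first exact: subspace_preimage.
  by exists P' => // u v Pu; rewrite /preimage /= tensor_mapE; apply/PE/rP.
move=> u; have [Q oQ QE] := El (r u).
by exists Q => // v Qv; rewrite /preimage /= tensor_mapE; exact: QE.
Qed.

(** The map S sends tens x v to sigma x v, with sigma linear from X to the
    functions V -> X (x) U.  The conditions on the function sigma x (linearity,
    restricting to tens x along j, being small on some open subspace) define a
    linear relation G between X and these functions, and sigma is obtained by
    uniformizing it.  The relation is total because for each x alone an adapted
    retraction of j exists; on P the function x |-> tens x (s _) is prescribed. *)
Lemma twisted_retraction (X U V : linTopType k) (j : hom U V) (P : set X)
    (s : {linear V -> U}) (E : set (tensor X U)) :
  embedding j -> cancel j s -> subspace_set P -> subspace_set E ->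
  (forall x, exists2 Q : set U, open_subspace Q & forall u, Q u -> E (tens x u)) ->
  (forall x, P x -> exists2 Q : set V, open_subspace Q &
     forall v, Q v -> E (tens x (s v))) ->
  exists S : {linear tensor X V -> tensor X U},
    [/\ cancel (tensor_map (hom_id X) j) S,
        forall x v, P x -> S (tens x v) = tens x (s v)
      & forall x, exists2 Q : set V, open_subspace Q &
          forall v, Q v -> E (S (tens x v))].
Proof.
move=> ej js sP sE Eu Es.
pose G := [set z : X * (V -> tensor X U) | [/\ linear z.2,
  forall u, z.2 (j u) = tens z.1 u &
  exists2 Q : set V, open_subspace Q & forall v, Q v -> E (z.2 v)]].
have sG : subspace_set G.
  split.
    split=> /= [a v w|u|]; first by rewrite scaler0 addr0.
    - by rewrite tens0l.
    - by exists setT => [|v _]; [exact: open_subspaceT|exact: subspace0].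
  move=> a [x w] [x' w'] [/= lw jw [Q oQ QE]] [/= lw' jw' [Q' oQ' QE']].
  have wE v : (a *: w + w') v = a *: w v + w' v by [].
  split=> /=.
  - move=> b v v'; rewrite !wE lw lw' !scalerDr !scalerA [a * b]mulrC.
    by rewrite -!addrA; congr (_ + _); rewrite addrCA.
  - by move=> u; rewrite wE jw jw' tens_linearl.
  - exists (Q `&` Q') => [|v [Qv Qv']]; first exact: open_subspaceI.
    by case: sE => _; apply; [exact: QE|exact: QE'].
pose H := [set z : X * (V -> tensor X U) |
  P z.1 /\ z.2 = fun v => tens z.1 (s v)].
have [||||sigma [sigmaG sigmaH]] := @linear_uniformization k X (V -> tensor X U) G H.
- exact: sG.
- split; first by split; [exact: subspace0|apply/funext => v; rewrite tens0l].
  move=> a [x w] [x' w'] [/= Px ->] [/= Px' ->]; split; first by case: sP => _; exact.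
  by apply/funext => v /=; rewrite tens_linearl.
- move=> [x w] [/= Px ->]; split=> /=.
  + by move=> a v v'; rewrite linearP tens_linearr.
  + by move=> u; rewrite js.
  + exact: Es.
- by move=> w [_ /= ->]; apply/funext => v; rewrite tens0l.
have {}sigmaG x : G (x, sigma x).
  have [Q oQ QE] := Eu x.
  have [r [Q' [jr oQ' rQ]]] := embedding_retraction ej oQ.
  apply: (sigmaG x (fun v => tens x (r v))); split=> /=.
  - by move=> a v v'; rewrite linearP tens_linearr.
  - by move=> u; rewrite jr.
  - by exists Q' => // v /rQ /QE.
have bl v : linear (fun x => sigma x v) by move=> a x y; rewrite linearP.
have br x : linear (sigma x) by have [] := sigmaG x.
pose S : {linear tensor X V -> tensor X U} := tensor_lift bl br.
have SE x v : S (tens x v) = sigma x v by exact: tensor_liftE.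
exists S; split.
- have ext := @tensor_linear_ext _ _ _ _ (S \o tensor_map (hom_id X) j) idfun.
  apply: ext => x u; rewrite [LHS]/= tensor_mapE SE.
  by have [_ sigmaj _] := sigmaG x; exact: sigmaj.
- move=> x v Px; rewrite SE.
  by rewrite (sigmaH x (fun v => tens x (s v))).
- move=> x; have [_ _ [Q oQ QE]] := sigmaG x.
  by exists Q => // v Qv; rewrite SE; exact: QE.
Qed.

(** Here s is any retraction of j: for x in P all of tens x _ lies in E. *)
Lemma arrow_embeddingr (X U V : linTopType k) (j : hom U V) :
  embedding j -> embedding (tensor_arrow_map (hom_id X) j).
Proof.
move=> ej; apply: embedding_of_retractions => E /arrow_openP [sE [P oP PE] El].
have [s [_ [js _ _]]] := embedding_retraction ej (open_subspaceT U).
have [x Px|S [jS SP SQ]] := twisted_retraction ej js oP.1 sE El.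
  by exists setT => [|v _]; [exact: open_subspaceT|exact: PE].
exists S; split=> //; apply/arrow_openP; split=> //; first exact: subspace_preimage.
by exists P => // x v Px; rewrite /preimage /= SP //; exact: PE.
Qed.

(** Prescribing a single s on P serves two purposes: s is adapted to Q, which
    makes P (x) Q' small, and for fixed v the vector s v does not depend on x,
    which makes the subspaces P_v available. *)
Lemma star_embeddingr (X U V : linTopType k) (j : hom U V) :
  embedding j -> embedding (tensor_star_map (hom_id X) j).
Proof.
move=> ej; apply: embedding_of_retractions => E.
move=> /star_openP [sE [P [Q [oP oQ PQE]]] El Er].
have [s [Q' [js oQ' sQ]]] := embedding_retraction ej oQ.
have [x Px|S [jS SP SQ]] := twisted_retraction ej js oP.1 sE El.
  by exists Q' => // v /sQ; exact: PQE.
exists S; split=> //; apply/star_openP; split=> //; first exact: subspace_preimage.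
  exists P, Q'; split=> // x v Px Qv.
  by rewrite /preimage /= SP //; exact/PQE/sQ.
move=> v; have [P' oP' P'E] := Er (s v).
exists (P `&` P') => [|x [Px P'x]]; first exact: open_subspaceI.
by rewrite /preimage /= SP //; exact: P'E.
Qed.

Section Swap.
Variables U V : linTopType k.

Definition swap : {linear tensor U V -> tensor V U} :=
  @tensor_lift k U V _ (fun u v => tens v u)
    (@tens_linearr k V U) (@tens_linearl k V U).

Lemma swapE u v : swap (tens u v) = tens v u.
Proof. exact: tensor_liftE. Qed.

Lemma swap_open (E : set (tensor V U)) :
  open_subspace (E : set (tensor_star V U)) ->
  open_subspace (swap @^-1` E : set (tensor_star U V)).
Proof.
move=> /star_openP [sE [P [Q [oP oQ PQE]]] El Er]; apply/star_openP; split.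
- exact: subspace_preimage.
- by exists Q, P; split=> // u v Qu Pv; rewrite /preimage /= swapE; exact: PQE.
- by move=> u; have [A oA AE] := Er u; exists A => // v Av;
    rewrite /preimage /= swapE; exact: AE.
- by move=> v; have [A oA AE] := El v; exists A => // u Au;
    rewrite /preimage /= swapE; exact: AE.
Qed.

End Swap.

Lemma swapK (U V : linTopType k) : cancel (swap U V) (swap V U).
Proof.
have ext := @tensor_linear_ext _ _ _ _ (swap V U \o swap U V) idfun.
by apply: ext => u v /=; rewrite !swapE.
Qed.

Lemma swap_map (U U' V V' : linTopType k) (f : hom U U') (g : hom V V') x :
  swap U' V' (tensor_map f g x) = tensor_map g f (swap U V x).
Proof.
have ext := @tensor_linear_ext _ _ _ _ (swap U' V' \o tensor_map f g)
  (tensor_map g f \o swap U V).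
by apply: ext => u v /=; rewrite tensor_mapE !swapE tensor_mapE.
Qed.

(** The topology of this tensor product is symmetric, so the previous case is
    transported along the swap of the factors. *)
Lemma star_embeddingl (X U V : linTopType k) (i : hom U V) :
  embedding i -> embedding (tensor_star_map i (hom_id X)).
Proof.
have swap_i z : tensor_map (hom_id X) i (swap U X z) =
    swap V X (tensor_map i (hom_id X) z) by rewrite swap_map.
move=> /(star_embeddingr X) [inj_i top_i]; split=> [x y xy|E /swap_open /top_i].
  apply: (can_inj (@swapK U X)); apply: inj_i.
  rewrite [LHS]swap_i [RHS]swap_i; exact: (congr1 (swap V X) xy).
move=> [E' /swap_open oE' E'E]; exists (swap V X @^-1` E') => // x.
rewrite /preimage /= -[swap V X _]swap_i => /E'E.
by rewrite /preimage /= swapK.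
Qed.

Lemma tensor_map_addr (X U V : linTopType k) (f g : hom U V) :
  tensor_map (hom_id X) (hom_add f g) =1
  tensor_map (hom_id X) f \+ tensor_map (hom_id X) g.
Proof.
have ext := @tensor_linear_ext _ _ _ _ (tensor_map (hom_id X) (hom_add f g))
  (tensor_map (hom_id X) f \+ tensor_map (hom_id X) g).
by apply: ext => u v /=; rewrite !tensor_mapE -tensDr.
Qed.

Lemma tensor_map_addl (X U V : linTopType k) (f g : hom U V) :
  tensor_map (hom_add f g) (hom_id X) =1
  tensor_map f (hom_id X) \+ tensor_map g (hom_id X).
Proof.
have ext := @tensor_linear_ext _ _ _ _ (tensor_map (hom_add f g) (hom_id X))
  (tensor_map f (hom_id X) \+ tensor_map g (hom_id X)).
by apply: ext => u v /=; rewrite !tensor_mapE -tensDl.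
Qed.

End TensorOpen.

Theorem theorem12p11 (k : fieldType) :
  [/\ [/\ in_each_argument (@preserves_kernels k) (star_functor k),
          in_each_argument (@preserves_cokernels k) (star_functor k)
        & in_each_argument (@exact_functor k) (star_functor k)],
      [/\ in_each_argument (@preserves_kernels k) (arrow_functor k),
          in_each_argument (@preserves_cokernels k) (arrow_functor k)
        & in_each_argument (@exact_functor k) (arrow_functor k)]
    & [/\ in_each_argument (@preserves_kernels k) (shriek_functor k),
          in_each_argument (@preserves_cokernels k) (shriek_functor k)
        & in_each_argument (@exact_functor k) (shriek_functor k)]].
Proof.
split; apply: bifunctor_exactness => X; split; apply: exactness_criterion.
- by move=> U V f g; apply: homP; exact: tensor_map_addr.
- by move=> U V i; exact: star_embeddingr.
- by move=> U V p; apply: star_quotient_map; exact: quotient_map_id.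
- by move=> U V W f g; exact: tensor_map_exactr.
- by move=> U V f g; apply: homP; exact: tensor_map_addl.
- by move=> U V i; exact: star_embeddingl.
- by move=> U V p qp; apply: star_quotient_map => //; exact: quotient_map_id.
- by move=> U V W f g; exact: tensor_map_exactl.
- by move=> U V f g; apply: homP; exact: tensor_map_addr.
- by move=> U V i; exact: arrow_embeddingr.
- by move=> U V p; apply: arrow_quotient_map; exact: quotient_map_id.
- by move=> U V W f g; exact: tensor_map_exactr.
- by move=> U V f g; apply: homP; exact: tensor_map_addl.
- by move=> U V i; exact: arrow_embeddingl.
- by move=> U V p qp; apply: arrow_quotient_map => //; exact: quotient_map_id.
- by move=> U V W f g; exact: tensor_map_exactl.
- by move=> U V f g; apply: homP; exact: tensor_map_addr.
- by move=> U V i; apply: shriek_embedding; exact: embedding_id.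
- by move=> U V p; apply: shriek_quotient_map; exact: quotient_map_id.
- by move=> U V W f g; exact: tensor_map_exactr.
- by move=> U V f g; apply: homP; exact: tensor_map_addl.
- by move=> U V i ei; apply: shriek_embedding => //; exact: embedding_id.
- by move=> U V p qp; apply: shriek_quotient_map => //; exact: quotient_map_id.
- by move=> U V W f g; exact: tensor_map_exactl.
Qed.
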